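(* The Möbius function is linearly disjoint from all dynamical systems with zero topological entropy if and only if it is linearly disjoint from all surjective dynamical systems on the Gehman dendrite (i.e. systems $(D,f)$ with $D$ the Gehman dendrite and $f\colon D\to D$ a continuous surjection) with zero topological entropy.
   Context: A dynamical system $(X,T)$ is a compact metric space $X$ with a continuous map $T\colon X\to X$. The Möbius function $\mu\colon\mathbb{N}\to\{-1,0,1\}$ is given by $\mu(1)=1$, $\mu(n)=(-1)^k$ if $n$ is a product of $k$ distinct primes, and $\mu(n)=0$ otherwise. The Möbius function is linearly disjoint from $(X,T)$ if for each $x\in X$ and any continuous $\varphi\colon X\to\mathbb{C}$, $$\lim_{N\to\infty}\frac1N\sum_{n=1}^N\mu(n)\varphi(T^n(x))=0.$$ A dendrite is a locally connected continuum (compact connected metric space) containing no simple closed curve. The Gehman dendrite is the topologically unique dendrite whose set of all endpoints is homeomorphic to the Cantor set and whose branching points are all of order three. Here the order (valence) of a point $v$ is the supremum of the numbers $n$ such that there are $n$ arcs in the space with common endpoint $v$ that pairwise intersect only at $v$; endpoints are the points of order $1$ and branching points are the points of order at least $3$. *)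

(* Defs.v *)
From mathcomp Require Import all_boot all_order all_algebra finmap.
From mathcomp Require Import all_classical all_reals all_analysis.
From mathcomp Require Import complex.

Set Implicit Arguments.
Unset Strict Implicit.
Unset Printing Implicit Defensive.

Import Order.TTheory GRing.Theory Num.Theory.
Import numFieldNormedType.Exports.

Local Open Scope classical_set_scope.
Local Open Scope ring_scope.

Definition mobius (n : nat) : int :=
  if n == (\prod_(p <- primes n) p)%N then (-1) ^+ size (primes n) else 0.

Definition dynamical_system (R : realType) (X : metricType R) (T : X -> X) :=
  compact [set: X] /\ continuous T.

(* The regular algebra R[i]^o is what carries the topology of the modulus. *)
Definition mobius_disjoint (R : realType) (X : metricType R) (T : X -> X) :=
  forall (x : X) (phi : X -> R[i]^o), continuous phi ->
    (fun N : nat => N%:R^-1 *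
       \sum_(1 <= n < N.+1) (mobius n)%:~R * phi (iter n T x) : R[i]^o)
      @ \oo --> (0 : R[i]^o).

(* Topological entropy, after Bowen and Dinaburg. *)
Section entropy.
Context {R : realType} {X : metricType R} (T : X -> X).

Definition bowen_dist (n : nat) (x y : X) : R :=
  \big[Order.max/0]_(i < n) mdist (iter i T x) (iter i T y).

Definition bowen_separated (n : nat) (e : R) (A : {fset X}) : Prop :=
  forall x y, x \in A -> y \in A -> x != y -> e < bowen_dist n x y.

Definition separation_number (n : nat) (e : R) : \bar R :=
  ereal_sup [set (#|` A|%:R)%:E | A in bowen_separated n e].

Definition entropy_at (e : R) : \bar R :=
  limn_esup (fun n => (n%:R^-1)%:E * lne (separation_number n e))%E.

(* entropy_at e grows as e decreases, so this supremum is its limit as e tends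
   to 0 from the right. *)
Definition topological_entropy : \bar R :=
  ereal_sup [set entropy_at e | e in [set e | 0 < e]].

End entropy.

Definition homeo_pair (S T : topologicalType) (f : S -> T) (g : T -> S) :=
  [/\ continuous f, continuous g, cancel f g & cancel g f].

Definition homeomorphic (S T : topologicalType) : Prop :=
  exists (f : S -> T) (g : T -> S), homeo_pair f g.

Definition unit_interval (R : realType) : set R := `[0, 1]%classic.

Definition unit_circle (R : realType) : set (R * R) :=
  [set z | z.1 ^+ 2 + z.2 ^+ 2 = 1].

(* A set used as a type below is its set_type, with the subspace topology. *)
Section curves.
Context {R : realType} {X : metricType R}.
Implicit Types (A : set X) (v w : X).

Definition simple_closed_curve A : Prop :=
  homeomorphic A (unit_circle (R:=R)).

Definition arc_between A v w : Prop :=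
  exists (f : A -> unit_interval (R:=R)) (g : unit_interval (R:=R) -> A),
    [/\ homeo_pair f g,
        forall t, \val t = 0 -> \val (g t) = v &
        forall t, \val t = 1 -> \val (g t) = w].

Definition arc_at v A : Prop := exists w, arc_between A v w.

Definition star_at v (n : nat) : Prop :=
  exists A : 'I_n -> set X,
    (forall i, arc_at v (A i)) /\
    (forall i j, i != j -> A i `&` A j = [set v]).

Definition point_order v : \bar R :=
  ereal_sup [set (n%:R)%:E | n in star_at v].

Definition endpoint v : Prop := point_order v = 1%:E.

Definition branching_point v : Prop := (3%:E <= point_order v)%E.

End curves.

Definition locally_connected (X : topologicalType) : Prop :=
  forall (x : X) (U : set X), nbhs x U ->
    exists V : set X, [/\ open V, connected V, V x & V `<=` U].

Definition continuum (R : realType) (X : metricType R) : Prop :=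
  [/\ [set: X] !=set0, compact [set: X] & connected [set: X]].

Definition dendrite (R : realType) (X : metricType R) : Prop :=
  [/\ continuum X, locally_connected X &
      forall A : set X, ~ simple_closed_curve A].

Definition gehman_dendrite (R : realType) (X : metricType R) : Prop :=
  [/\ dendrite X,
      homeomorphic [set v : X | endpoint v] cantor_space &
      forall v : X, branching_point v -> point_order v = 3%:E].

(* Main.v *)
(** Only the direction from dendrites to arbitrary systems needs an argument.

    Let (X, T) have zero entropy and let x be a point of X. The orbit of x is shadowed,
    within any prescribed distance, by a sequence z with finitely many values and
    subexponential block growth. To obtain z, approximate blocks of the orbit of length
    n_0 | n_1 | n_2 | ... by the orbits of the points of small spanning sets, in such a
    way that the approximating words of one level are concatenations of words of the
    previous levels. By linearity and uniform continuity it suffices to treat the binary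
    sequences [z n == y].

    The infinite binary tree is a model of the Gehman dendrite whose ends are the binary
    sequences. Given a binary sequence z of subexponential growth, let f delete the first
    letter of a point, and, if that letter is [false], also retract the result onto the
    subtree spanned by the factors of z. Then f is onto, since it maps the subtree above
    [true] onto the tree; it has zero entropy, since the forward orbit of a point is
    determined, up to any given precision, by its coordinates on subexponentially many
    words; and it acts on the end z as the shift. *)

Require Import Defs.
From HB Require Import structures.
From mathcomp Require Import all_boot all_order all_algebra finmap.
From mathcomp Require Import all_classical all_reals all_analysis.
From mathcomp Require Import complex.
From mathcomp Require Import zify ring lra.

Set Implicit Arguments.
Unset Strict Implicit.
Unset Printing Implicit Defensive.

Import Order.TTheory GRing.Theory Num.Theory.
Import numFieldNormedType.Exports.

Local Open Scope classical_set_scope.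
Local Open Scope ring_scope.

(** * Entropy and shadowing *)

Section bowen.
Context {R : realType} {X : metricType R} (T : X -> X).

Lemma bowen_distP n (x y : X) (e : R) : 0 <= e ->
  reflect (forall i, (i < n)%N -> mdist (iter i T x) (iter i T y) <= e)
          (bowen_dist T n x y <= e).
Proof.
move=> e0; apply: (iffP (bigmax_leP _ _ _ _)) => [[_ h] i ilt|h].
  exact: (h (Ordinal ilt)).
by split=> // i _; exact: h.
Qed.

Lemma bowen_distC n (x y : X) : bowen_dist T n x y = bowen_dist T n y x.
Proof. by apply: eq_bigr => i _; rewrite metric_sym. Qed.

Lemma separated_set_le_separation_number n (e : R) (A : {fset X}) :
  bowen_separated T n e A ->
  ((#|` A|%:R)%:E <= separation_number T n e)%E.
Proof. by move=> sA; apply: ereal_sup_ubound; exists A. Qed.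

Lemma separation_number_ge0 n (e : R) : (0 <= separation_number T n e)%E.
Proof.
have := @separated_set_le_separation_number n e fset0.
by rewrite cardfs0; apply=> x y; rewrite in_fset0.
Qed.

Lemma separation_number_lt_expR (e d : R) :
  (entropy_at T e < d%:E)%E ->
  \forall n \near \oo, (separation_number T n e <= (expR (d * n%:R))%:E)%E.
Proof.
rewrite /entropy_at /limn_esup /limf_esup => /ereal_inf_lt[_ [V /= FV <-]] Vd.
near=> n.
have n0 : (0 < n)%N by near: n; exact: nbhs_infty_gt.
have Vn : V n by near: n; exact: FV.
have : ((n%:R^-1)%:E * lne (separation_number T n e) <= d%:E)%E.
  by apply: le_trans (ltW Vd); apply: ereal_sup_ubound; exists n.
rewrite lee_pdivrMl ?ltr0n// => h.
rewrite -[leLHS]lneK ?in_itv/= ?separation_number_ge0 ?leey//.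
have -> : (expR (d * n%:R))%:E = expeR (d * n%:R)%:E by [].
by rewrite lee_expeR (le_trans h)// -EFinM lee_fin mulrC.
Unshelve. all: by end_near. Qed.

(* A separated set of maximal cardinality is spanning. *)
Lemma spanning_set n (e : R) (B : R) : 0 <= e ->
  (separation_number T n e <= B%:E)%E ->
  exists s : seq X, (size s)%:R <= B /\
    forall y, exists2 z, z \in s & bowen_dist T n y z <= e.
Proof.
move=> e0 sB.
pose P k := `[< exists2 A : {fset X}, bowen_separated T n e A & #|` A| = k >].
have P0 : exists k, P k.
  by exists 0%N; apply/asboolP; exists fset0; rewrite ?cardfs0.
have leB A : bowen_separated T n e A -> (#|` A|)%:R <= B.
  move=> /separated_set_le_separation_number h.
  by rewrite -lee_fin; exact: le_trans sB.
have Pb k : P k -> (k <= Num.trunc B)%N.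
  move=> /asboolP[A sA <-]; rewrite truncn_ge_nat; first exact: leB.
  by rewrite (le_trans _ (leB A sA)).
case: (ex_maxnP P0 Pb) => k /asboolP[A sA cA] kmax.
exists (enum_fset A); split; first exact: leB.
move=> y; case: (pselect (y \in A)) => [yA|yA].
  by exists y => //; apply/bowen_distP => // i _; rewrite mdistxx.
apply: contrapT => h.
have far z : z \in A -> e < bowen_dist T n y z.
  by move=> zA; rewrite ltNge; apply/negP => hz; apply: h; exists z.
have : P #|` (y |` A)%fset|.
  apply/asboolP; exists (y |` A)%fset => // a b.
  rewrite !in_fset1U => /orP[/eqP->|aA] /orP[/eqP->|bA]; rewrite ?eqxx// => ab.
  - exact: far.
  - by rewrite bowen_distC; exact: far.
  - exact: sA.
move=> /kmax; rewrite cardfsU1; move/negP: yA => ->; lia.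
Qed.

Lemma spanning_set_zero_entropy (e d : R) : topological_entropy T = 0%E ->
  0 < e -> 0 < d ->
  exists N, forall n, (N <= n)%N ->
    exists s : seq X, (size s)%:R <= expR (d * n%:R) /\
      forall y, exists2 z, z \in s & bowen_dist T n y z <= e.
Proof.
move=> ent0 e0 d0.
have : (entropy_at T e < d%:E)%E.
  rewrite (@le_lt_trans _ _ 0%E) ?lte_fin// -ent0.
  by apply: ereal_sup_ubound; exists e.
move=> /separation_number_lt_expR[N _ hN]; exists N => n Nn.
exact: (spanning_set (ltW e0) (hN n Nn)).
Qed.

End bowen.

(** Zero entropy of a sequence, tested on aligned blocks of one length [l] per rate [e]. Such blocks
    are what the shadowing construction controls; [low_complexity_factors] passes to factors at
    arbitrary positions and of every length. *)
Definition low_complexity (R : realType) (A : Type) (z : nat -> A) : Prop :=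
  forall e : R, 0 < e -> exists l M (W : nat -> nat -> A),
    [/\ (0 < l)%N, M%:R <= expR (e * l%:R) &
        forall q, exists2 j, (j < M)%N &
          forall r, (r < l)%N -> z (q * l + r)%N = W j r].

Lemma low_complexity_comp (R : realType) (A B : Type) (f : A -> B) (z : nat -> A) :
  low_complexity R z -> low_complexity R (f \o z).
Proof.
move=> lz e /lz[l [M [W [l0 MW zW]]]].
exists l, M, (fun j r => f (W j r)); split=> // q.
by have [j jM jW] := zW q; exists j => // r /jW /= ->.
Qed.

(** * Shadowing an orbit by a finite-valued sequence of low complexity *)

Section shadowing.
Context {R : realType} {X : metricType R} (T : X -> X).
Hypothesis ent0 : topological_entropy T = 0%E.
Variable d : R.
Hypothesis d0 : 0 < d.

(** The tolerances sum to [d], so the errors accumulated over any number of levels stay below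
    [d]. *)
Let tol (k : nat) : R := d / 2 ^+ k.+1.
Let rate (k : nat) : R := k.+1%:R^-1.

Let threshold : {N : nat -> nat & forall k n, (N k <= n)%N ->
  exists s : seq X, (size s)%:R <= expR (rate k * n%:R) /\
    forall y, exists2 z, z \in s & bowen_dist T n y z <= tol k}.
Proof.
apply: (@choice _ _ (fun k N => forall n, (N <= n)%N ->
  exists s : seq X, (size s)%:R <= expR (rate k * n%:R) /\
    forall y, exists2 z, z \in s & bowen_dist T n y z <= tol k)) => k.
apply: spanning_set_zero_entropy => //; first by rewrite divr_gt0// exprn_gt0.
by rewrite invr_gt0.
Qed.

Let N := projT1 threshold.

(** Each length divides the next, so that aligned blocks nest, and [len k] is at least [N k], so
    that a small spanning set exists. The [.+2] forces strict growth. *)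
Let len := fix len k := if k is k'.+1 then (len k' * (N k).+2)%N else (N 0%N).+1.

Let ltn_len k : (k < len k)%N.
Proof. by elim: k => //= k IH; nia. Qed.

Let leq_len j k : (j <= k)%N -> (len j <= len k)%N.
Proof.
elim: k => [|k IH]; first by rewrite leqn0 => /eqP->.
rewrite leq_eqVlt => /predU1P[->//|/IH h]; apply: leq_trans h _ => /=; nia.
Qed.

Let dvdn_len j k : (j <= k)%N -> (len j %| len k)%N.
Proof.
elim: k => [|k IH]; first by rewrite leqn0 => /eqP->.
rewrite leq_eqVlt => /predU1P[->//|/IH h]; exact: dvdn_mulr.
Qed.

Let net : {s : nat -> seq X & {rho : nat -> X -> X & forall k,
  (size (s k))%:R <= expR (rate k * (len k)%:R) /\
  forall y, rho k y \in s k /\ bowen_dist T (len k) y (rho k y) <= tol k}}.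
Proof.
have /choice[s hs] : forall k, exists s : seq X,
    (size s)%:R <= expR (rate k * (len k)%:R) /\
    forall y, exists2 z, z \in s & bowen_dist T (len k) y z <= tol k.
  move=> k; apply: (projT2 threshold) => /=; case: k => [|k] /=; first exact: leqnSn.
  have := ltn_len k; rewrite -/N; nia.
have /choice[rho hrho] : forall k, exists rho : X -> X, forall y,
    rho y \in s k /\ bowen_dist T (len k) y (rho y) <= tol k.
  move=> k; suff /choice[f hf] : forall y, exists z,
      z \in s k /\ bowen_dist T (len k) y z <= tol k by exists f.
  by move=> y; have [_ /(_ y)[z]] := hs k; exists z.
by exists s, rho => k; split; [exact: (hs k).1|exact: hrho].
Qed.

Let s := projT1 net.
Let rho := projT1 (projT2 net).

Let rho_in k y : rho k y \in s k.
Proof. by have [_ /(_ y)[]] := projT2 (projT2 net) k. Qed.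

Let tol_ge0 k : 0 <= tol k.
Proof. by rewrite divr_ge0 ?exprn_ge0// ltW. Qed.

Let rho_near k y i : (i < len k)%N ->
  mdist (iter i T y) (iter i T (rho k y)) <= tol k.
Proof.
by move=> h; have [_ /(_ y)[_ /(bowen_distP _ _ _ _ (tol_ge0 k))]] := projT2 (projT2 net) k; exact.
Qed.

(* At level k.+1 each aligned block of length len k.+1 of the orbit is replaced
   by the level k approximation of the orbit of its representative: the blocks
   at one level are then concatenations of blocks at every lower level. *)
Let approx := fix approx k (y : X) (i : nat) : X :=
  if k is k'.+1 then
    approx k' (rho k (iter (i %/ len k * len k) T y)) (i %% len k)%N
  else rho 0%N (iter i T y).

Let approx_in k y i : approx k y i \in s 0%N.
Proof. by elim: k y i => [|k IH] y i /=; [exact: rho_in|exact: IH]. Qed.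

(** The bound is the sum of [tol j] over [j <= k]: one level replaces an orbit block by the orbit of
    its representative, and the lower levels then approximate the latter. *)
Let approx_near k y i :
  mdist (iter i T y) (approx k y i) <= d * (1 - (2 ^+ k.+1)^-1).
Proof.
elim: k y i => [|k IH] y i.
  rewrite (le_trans (rho_near (iter i T y) (ltn_len 0)))//= /tol expr1; lra.
rewrite /= -/(len k.+1); set l := len k.+1.
rewrite {1}(divn_eq i l) [X in iter X]addnC iterD.
set y' := iter _ T y.
have h1 := @rho_near k.+1 y' (i %% l) (ltn_pmod i (leq_trans _ (ltn_len k.+1))).
rewrite (le_trans (metric_triangle _ (iter (i %% l) T (rho k.+1 y')) _))//.
rewrite (le_trans (lerD (h1 _) (IH _ _)))// /tol.
rewrite [2 ^+ k.+2]exprS invfM; lra.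
Qed.

(** By divisibility an aligned block of length [len j.+1] lies inside one block of length
    [len k.+1], where the sequence is itself a level [k] approximation; this drives the induction.
    The number of possible blocks is thus bounded independently of [k]. *)
Let approx_block j k y q : (j < k)%N -> exists2 z, z \in s j.+1 &
  forall r, (r < len j.+1)%N -> approx k y (q * len j.+1 + r)%N = approx j z r.
Proof.
elim: k y q => // k IH y q; rewrite ltnS leq_eqVlt => /predU1P[->|jk].
  exists (rho k.+1 (iter (q * len k.+1) T y)) => // r rl.
  rewrite [LHS]/= -/(len k.+1) divnMDl ?modnMDl ?divn_small ?modn_small ?addn0//.
  exact: leq_ltn_trans rl.
have [m lm] := dvdnP (@dvdn_len j.+1 k.+1 (leqW jk)).
set l := len j.+1 in lm *; have l0 : (0 < l)%N := leq_ltn_trans (leq0n _) (ltn_len j.+1).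
have m0 : (0 < m)%N by have := ltn_len k.+1; rewrite lm; case: m {lm}.
have [z zs hz] := IH (rho k.+1 (iter (q %/ m * len k.+1) T y)) (q %% m)%N jk.
exists z => // r rl; rewrite -(hz r rl) [LHS]/= -/(len k.+1) -/l.
have e : (q * l + r = q %/ m * len k.+1 + (q %% m * l + r))%N.
  by rewrite lm mulnA addnA -mulnDl -divn_eq.
have lt : (q %% m * l + r < len k.+1)%N.
  by rewrite lm; have := ltn_pmod q m0; nia.
by rewrite e divnMDl ?modnMDl ?(divn_small lt) ?(modn_small lt) ?addn0// (leq_ltn_trans _ lt).
Qed.

Let level_ex i : exists k, (i < len k.+1)%N.
Proof. by exists i; rewrite (ltn_trans (ltnSn i))// (ltn_len i.+1). Qed.

Let level i := ex_minn (level_ex i).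

Let level_lt i : (i < len (level i).+1)%N.
Proof. by rewrite /level; case: ex_minnP. Qed.

Let level_min i k : (i < len k.+1)%N -> (level i <= k)%N.
Proof. by rewrite /level; case: ex_minnP => m _; exact. Qed.

(** A fixed level controls blocks only up to a bounded length, so the level has to grow with the
    index. *)
Let shadow (x : X) i := approx (level i) x i.

(** Past the initial block the level exceeds [j], and it changes only at some [len k] that is a
    multiple of [len j.+1]. It is therefore constant on each aligned block, and [approx_block]
    applies. *)
Let shadow_block x j q : (0 < q)%N -> exists2 z, z \in s j.+1 &
  forall r, (r < len j.+1)%N -> shadow x (q * len j.+1 + r)%N = approx j z r.
Proof.
move=> q0; set l := len j.+1; set k := level (q * l).
have l0 : (0 < l)%N := leq_ltn_trans (leq0n _) (ltn_len j.+1).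
have jk : (j < k)%N.
  rewrite ltnNge; apply/negP => kj.
  have := level_lt (q * l); rewrite -/k.
  by have := @leq_len k.+1 j.+1 kj; rewrite -/l; nia.
have [z zs hz] := @approx_block j k x q jk; exists z => // r rl.
rewrite -hz// /shadow; congr (approx _ _ _).
have [m lm] := dvdnP (@dvdn_len j.+1 k.+1 (leqW jk)).
have lt := level_lt (q * l); rewrite -/k lm -/l in lt.
have qm : (q < m)%N by move: lt; rewrite ltn_pmul2r.
apply/eqP; rewrite eqn_leq; apply/andP; split.
  by apply: level_min; rewrite lm -/l; nia.
by apply: level_min; have := level_lt (q * l + r); lia.
Qed.

Lemma exists_shadow (x : X) : exists2 z : nat -> X,
  low_complexity R z &
  exists2 E : seq X, (forall i, z i \in E) &
    forall i, mdist (iter i T x) (z i) <= d.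
Proof.
exists (shadow x); last first.
  exists (s 0%N) => i; first exact: approx_in.
  by rewrite (le_trans (approx_near _ _ _))// ler_piMr ?(ltW d0)//.
move=> e e0.
(* [2 / e <= j.+1] serves twice: it makes the rate at level [j.+1] at most [e / 2] and, as [l]
   exceeds [j.+1], it makes [e / 2 * l] at least 1. *)
pose j := Num.truncn (2 / e); pose l := len j.+1.
have l0 : (0 < l)%N := leq_ltn_trans (leq0n _) (ltn_len j.+1).
have je : 2 / e <= j.+1%:R by exact/ltW/truncnS_gt.
have re : rate j.+1 <= e / 2.
  rewrite -[e / 2]invrK lef_pV2 ?posrE ?invr_gt0 ?divr_gt0// invf_div.
  by rewrite (le_trans je)// ler_nat.
(* Word 0 is the initial block, which [shadow_block] does not cover; the other words come from the
   net at level [j.+1]. *)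
exists l, (size (s j.+1)).+1, (fun i r =>
  if i is i'.+1 then approx j (nth x (s j.+1) i') r else shadow x r).
split=> //.
- have [+ _] := projT2 (projT2 net) j.+1; rewrite -/s -/l => h.
  have el : 1 <= e / 2 * l%:R.
    rewrite (@le_trans _ _ (e / 2 * j.+1%:R))//.
      by rewrite -ler_pdivrMl ?divr_gt0// mulr1 invf_div.
    by rewrite ler_pM2l ?divr_gt0// ler_nat ltnW// (ltnW (ltn_len j.+1)).
  (* The extra word is absorbed: [t + 1 <= t * t] because [t >= 2]. *)
  set t := expR (e / 2 * l%:R).
  have t2 : 2 <= t by apply: le_trans (expR_ge1Dx _); rewrite -lerBlDl (le_trans _ el)// lerBlDr.
  have ht : (size (s j.+1))%:R <= t.
    by rewrite (le_trans h)// ler_expR ler_wpM2r// ler0n.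
  have -> : expR (e * l%:R) = t * t by rewrite /t -expRD; congr expR; field.
  rewrite -natr1; nra.
- case=> [|q]; first by exists 0%N.
  have [z zs hz] := @shadow_block x j q.+1 isT.
  by exists (index z (s j.+1)).+1; rewrite ?ltnS ?index_mem// => r rl; rewrite nth_index// hz.
Qed.

End shadowing.

(** * Counting factors *)

Definition factor (A : Type) (z : nat -> A) (s k : nat) : seq A :=
  mkseq (fun i => z (s + i)%N) k.

(** A factor of length [k] can be read off from its offset modulo [l] and [K = k %/ l + 2]
    consecutive aligned blocks, each one of [M] words. This leaves [l * M ^ K] candidates; the two
    extra blocks only cost the constant [expR (e * (2 * l))]. *)
Lemma low_complexity_factors (R : realType) (A : eqType) (z : nat -> A) (e : R) :
  low_complexity R z -> 0 < e ->
  exists2 C : R, 0 <= C & forall k, exists L : seq (seq A),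
    (size L)%:R <= C * expR (e * k%:R) /\ forall s, factor z s k \in L.
Proof.
move=> lz e0; have [l [M [W [l0 MW zW]]]] := lz e e0.
have /choice[j hj] : forall q, exists j, (j < M)%N /\
    forall r, (r < l)%N -> z (q * l + r)%N = W j r.
  by move=> q; have [j] := zW q; exists j.
case: M MW zW hj => [|M] MW zW hj; first by have [] := zW 0%N.
exists (l%:R * expR (e * (2 * l%:R))); first by rewrite mulr_ge0 ?expR_ge0.
move=> k; set K := (k %/ l).+2.
pose word (r : nat) (t : K.-tuple 'I_M.+1) :=
  mkseq (fun i => W (nth ord0 t ((r + i) %/ l)) ((r + i) %% l)%N) k.
exists [seq word r t | r <- iota 0 l, t <- enum {: K.-tuple 'I_M.+1}]; split.
  rewrite size_allpairs size_iota -cardE card_tuple card_ord natrM -mulrA.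
  rewrite ler_wpM2l ?ler0n// -expRD natrX.
  rewrite (@le_trans _ _ (expR (e * l%:R) ^+ K))// ?lerXn2r ?nnegrE ?expR_ge0//.
  rewrite -expRM_natl ler_expR mulrCA -mulrDr ler_pM2l// -!natrM -natrD ler_nat.
  by have := leq_divM k l; rewrite /K; lia.
move=> s; apply/allpairsP.
have tP b : (j (s %/ l + b) < M.+1)%N by have [] := hj (s %/ l + b)%N.
exists ((s %% l)%N, [tuple Ordinal (tP b) | b < K]) => /=; split.
- by rewrite mem_iota ltn_pmod.
- by rewrite mem_enum.
rewrite /factor /word; apply/eq_in_map => i; rewrite mem_iota /= add0n => ik.
set r := (s %% l)%N; set b := ((r + i) %/ l)%N.
have bK : (b < K)%N.
  rewrite ltn_divLR// /K; have := ltn_pmod s l0; rewrite -/r.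
  have := ltn_ceil k l0; lia.
have -> : nth ord0 [tuple Ordinal (tP b) | b < K] b = Ordinal (tP b).
  by rewrite -[b]/(nat_of_ord (Ordinal bK)) nth_mktuple.
have [_ <-] := hj (s %/ l + b)%N; last exact: ltn_pmod.
congr (z _); rewrite {1}(divn_eq s l) mulnDl -!addnA -/r; congr addn.
exact: divn_eq.
Qed.

(** * The binary tree *)

Section words.

Fixpoint short_words (m : nat) : seq (seq bool) :=
  if m is m'.+1 then
    [::] :: map (cons true) (short_words m') ++ map (cons false) (short_words m')
  else [:: [::]].

Lemma mem_short_words m u : (u \in short_words m) = (size u <= m)%N.
Proof.
elim: m u => [|m IH] [|b u] //=.
by rewrite in_cons /= mem_cat; case: b; rewrite ?ltnS -?IH;
  rewrite mem_map ?[in X in _ || X](introF mapP) ?[in X in X || _](introF mapP)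
    ?orbF//; try (by case=> ? _ []); try (by move=> ? ? []).
Qed.

End words.

(* A point of the infinite binary tree is encoded by the proportion [c (rcons u b)]
   of the edge from the node [u] to the node [rcons u b] that is covered by the
   path from the root to the point. *)
Section tree.
Context {R : realType}.

Definition tree_point (c : seq bool -> R) : Prop :=
  [/\ c [::] = 1, forall u, 0 <= c u <= 1,
      forall u b, c (rcons u b) * (1 - c u) = 0 &
      forall u, c (rcons u true) * c (rcons u false) = 0].

Record tree := Tree { coord :> seq bool -> R; treeP : tree_point coord }.

HB.instance Definition _ := gen_eqMixin tree.
HB.instance Definition _ := gen_choiceMixin tree.

Implicit Types c : tree.

Lemma tree_eqP (c c' : tree) : (forall u, c u = c' u) -> c = c'.
Proof.
case: c => f fP; case: c' => g gP /= /funext e; case: _ / e gP => gP.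
by congr Tree; exact: Prop_irrelevance.
Qed.

Lemma coord_nil c : c [::] = 1. Proof. by case: (treeP c). Qed.
Lemma coord_ge0 c u : 0 <= c u. Proof. by case: (treeP c) => _ /(_ u)/andP[]. Qed.
Lemma coord_le1 c u : c u <= 1. Proof. by case: (treeP c) => _ /(_ u)/andP[]. Qed.

Lemma coord_rcons c u b : 0 < c (rcons u b) -> c u = 1.
Proof.
case: (treeP c) => _ _ /(_ u b)/eqP + _.
by rewrite mulf_eq0 subr_eq0 => /orP[/eqP->|/eqP//]; rewrite ltxx.
Qed.

Lemma coord_sibling c u b : 0 < c (rcons u b) -> c (rcons u (~~ b)) = 0.
Proof.
case: (treeP c) => _ _ _ /(_ u)/eqP; rewrite mulf_eq0.
by case: b => /= /orP[]/eqP-> //; rewrite ltxx.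
Qed.

Let gap c c' (u : seq bool) : R := (2 ^+ size u)^-1 * `|c u - c' u|.

Let w_gt0 (u : seq bool) : 0 < (2 ^+ size u)^-1 :> R.
Proof. by rewrite invr_gt0 exprn_gt0. Qed.

Let w_le1 (u : seq bool) : (2 ^+ size u)^-1 <= 1 :> R.
Proof. by rewrite invf_le1 ?exprn_gt0// exprn_ege1// ler1n. Qed.

Lemma coord_dist_le1 c c' u : `|c u - c' u| <= 1.
Proof.
have := coord_ge0 c u; have := coord_le1 c u.
have := coord_ge0 c' u; have := coord_le1 c' u.
by move=> *; rewrite ler_norml; lra.
Qed.

Let gap_le1 c c' u : gap c c' u <= 1.
Proof.
rewrite (le_trans _ (coord_dist_le1 c c' u))// ler_piMl//.
Qed.

(** The weights make the coordinates on long words negligible; as each length has finitely many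
    words, this metric induces coordinatewise convergence. *)
Definition tree_dist c c' : R := sup (range (gap c c')).

Lemma tree_distP c c' e :
  tree_dist c c' <= e <-> forall u, (2 ^+ size u)^-1 * `|c u - c' u| <= e.
Proof.
split=> [h u|h].
  apply: le_trans h; apply: ub_le_sup; last by exists u.
  by exists 1 => _ [v _ <-].
apply: ge_sup => [|_ [u _ <-]]; last exact: h.
by exists (gap c c' [::]); exists [::].
Qed.

Let dist0 c : tree_dist c c = 0.
Proof.
apply/eqP; rewrite eq_le; apply/andP; split.
  by apply/tree_distP => u; rewrite subrr normr0 mulr0.
have /tree_distP/(_ [::]) := lexx (tree_dist c c).
by rewrite subrr normr0 mulr0.
Qed.

Let dist_eq0 c c' : tree_dist c c' = 0 -> c = c'.
Proof.
move=> h; apply: tree_eqP => u.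
have /tree_distP/(_ u) := lexx (tree_dist c c').
by rewrite h pmulr_rle0// normr_le0 subr_eq0 => /eqP.
Qed.

Let dist_sym c c' : tree_dist c c' = tree_dist c' c.
Proof.
rewrite /tree_dist (_ : gap c c' = gap c' c)//.
by apply/funext => u; rewrite /gap distrC.
Qed.

Let dist_triangle c2 c1 c3 :
  tree_dist c1 c3 <= tree_dist c1 c2 + tree_dist c2 c3.
Proof.
apply/tree_distP => u.
have /tree_distP/(_ u) h1 := lexx (tree_dist c1 c2).
have /tree_distP/(_ u) h2 := lexx (tree_dist c2 c3).
by rewrite (le_trans _ (lerD h1 h2))// -mulrDr ler_wpM2l ?ler_distD// ltW.
Qed.

HB.instance Definition _ :=
  isMetric.Build R tree dist0 dist_eq0 dist_sym dist_triangle.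

Lemma coord_dist_le c c' u : `|c u - c' u| <= 2 ^+ size u * mdist c c'.
Proof.
have /tree_distP/(_ u) := lexx (tree_dist c c').
by rewrite ler_pdivrMl// exprn_gt0.
Qed.

Lemma tree_coord_continuous (u : seq bool) : continuous (fun c : tree => c u : R).
Proof.
move=> c; have FF : Filter (nbhs c) by exact: nbhs_filter.
apply/cvgrPdist_lt => e e0.
have r0 : 0 < e / 2 ^+ size u by rewrite divr_gt0// exprn_gt0.
apply: filterS (nbhsx_ballx c _ r0) => c'.
rewrite ballEmdist/= ltr_pdivlMr ?exprn_gt0// mulrC.
exact: le_lt_trans (coord_dist_le c c' u).
Qed.

Lemma exists_expn_lt (e : R) : 0 < e -> exists m, (2 ^+ m)^-1 < e.
Proof.
move=> e0; exists (Num.truncn e^-1).+1.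
rewrite -[ltRHS]invrK ltf_pV2 ?posrE ?exprn_gt0 ?invr_gt0//.
by rewrite (lt_trans (truncnS_gt _))// -natrX ltr_nat ltn_expl.
Qed.

Lemma mdist_tree_le c c' (e : R) m : (2 ^+ m)^-1 <= e ->
  (forall u, (size u <= m)%N -> `|c u - c' u| <= e) -> mdist c c' <= e.
Proof.
move=> me h; apply/tree_distP => u.
have [um|mu] := leqP (size u) m.
  by rewrite (le_trans _ (h u um))// ler_piMl.
rewrite (le_trans _ me)// (@le_trans _ _ (2 ^+ size u)^-1)//.
  by rewrite ler_piMr ?coord_dist_le1// ltW.
by rewrite lef_pV2 ?posrE ?exprn_gt0// ler_eXn2l ?ltr1n// ltnW.
Qed.

Lemma tree_cvgP (Y : Type) (F : set_system Y) (FF : Filter F) (f : Y -> tree) c :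
  (forall u, (fun y => f y u : R) @ F --> (c u : R)) -> f @ F --> c.
Proof.
move=> h; apply/metricType_numDomainType.cvgrPdist_lt => e e0.
have [m me] := exists_expn_lt (divr_gt0 e0 (ltr0n R 2)).
suff : \forall y \near F, forall u, u \in short_words m ->
    `|c u - f y u| <= e / 2.
  apply: filterS => y hy; rewrite (@le_lt_trans _ _ (e / 2))//; last lra.
  by apply: mdist_tree_le (ltW me) _ => u um; apply: hy; rewrite mem_short_words.
elim: (short_words m) => [|v s IH].
  by apply: filterE => y u.
have hv : \forall y \near F, `|c v - f y v| <= e / 2.
  by move/cvgrPdist_le: (h v); apply; lra.
apply: filterS2 hv IH => y hv hs u; rewrite in_cons => /predU1P[->//|]; exact: hs.
Qed.

Lemma tree_continuous (Y : topologicalType) (f : Y -> tree) :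
  (forall u, continuous (fun y => f y u : R)) -> continuous f.
Proof. by move=> h y; apply: tree_cvgP => u; exact: h. Qed.

(** The conditions of [tree_point] are equations and weak inequalities between finitely many
    coordinates, so they survive the coordinatewise limit along an ultrafilter. *)
Lemma tree_compact : compact [set: tree].
Proof.
rewrite compact_ultra => F FU _; have FP : ProperFilter F := ultra_proper.
have /choice[l hl] : forall u, exists l : R,
    0 <= l <= 1 /\ (fun c : tree => c u : R) @ F --> l.
  move=> u; have : compact (`[0, 1]%classic : set R) by exact: segment_compact.
  rewrite compact_ultra.
  pose G : set_system R := (fun c : tree => c u : R) @ F.
  have GU : UltraFilter G.
    split=> [|H HP GH]; first exact: fmap_proper_filter.
    apply/seteqP; split=> //= A HA.
    have [//|FnA] := in_ultra_setVsetC ((fun c : tree => c u : R) @^-1` A) FU.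
    have /GH HnA : G (~` A) by [].
    have := filterI HA HnA; rewrite setICr => H0.
    by case: (@filter_not_empty _ H HP (H0 _)).
  have G01 : G `[0, 1]%classic.
    by apply: (@filterE _ F) => c; rewrite /= in_itv/= coord_ge0 coord_le1.
  move=> /(_ G GU G01)[l [/= l01 Gl]].
  by exists l; split=> //; rewrite in_itv/= in l01.
have lim (f : tree -> R) (a b : R) : (forall c, f c = b) -> f @ F --> a -> a = b.
  move=> fb fa; apply: (@cvg_unique _ (@Rhausdorff R) (f @ F)) => //.
  by rewrite (_ : f = fun=> b); [exact: cvg_cst|exact/funext].
have lP : tree_point l.
  split=> [|u|u b|u].
  - by apply: (lim _ _ _ _ (hl _).2) => c; exact: coord_nil.
  - exact: (hl u).1.
  - apply: (lim (fun c => c (rcons u b) * (1 - c u))).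
      by move=> c; case: (treeP c).
    by apply: cvgM (hl _).2 _; apply: cvgB (hl _).2; exact: cvg_cst.
  - apply: (lim (fun c => c (rcons u true) * c (rcons u false))).
      by move=> c; case: (treeP c).
    exact: cvgM (hl _).2 (hl _).2.
exists (Tree lP); split=> //=.
have -> : F = (@id tree) @ F by apply/funext => A; rewrite /= nbhs_simpl.
by apply: tree_cvgP => u; exact: (hl u).2.
Qed.

End tree.
Arguments tree : clear implicits.

Lemma metric_ball_open (R : realType) (X : metricType R) (x : X) (e : R) :
  open (ball x e).
Proof.
rewrite openE => y; rewrite ballEmdist/= => xy.
have r0 : 0 < e - mdist x y by rewrite subr_gt0.
apply: filterS (nbhsx_ballx y _ r0) => z; rewrite ballEmdist/=.
have := metric_triangle x y z; lra.
Qed.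

(** * Branches: points given by an end and a height *)

Section branch.
Context {R : realType}.
Implicit Types (x y : nat -> bool) (t s : R) (c : tree R).

(* Edges at depth k occupy the heights between 1 - 2^(1-k) and 1 - 2^-k. *)
Definition edge_ratio (k : nat) t : R :=
  Num.max 0 (Num.min 1 (2 - 2 ^+ k * (1 - Num.max 0 t))).

Lemma edge_ratio_bounds k t : 0 <= edge_ratio k t <= 1.
Proof. by rewrite le_max lexx ge_max ler01 ge_min lexx. Qed.

Lemma edge_ratio0 t : edge_ratio 0 t = 1.
Proof.
have : 0 <= Num.max 0 t by rewrite le_max lexx.
rewrite /edge_ratio; move: (Num.max 0 t) => m m0.
by rewrite expr0 mul1r min_l ?max_r//; lra.
Qed.

Lemma edge_ratio1 k : edge_ratio k 1 = 1.
Proof.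
rewrite /edge_ratio (@max_r _ _ 0 1)// subrr mulr0 subr0.
by rewrite min_l ?ler1n// max_r.
Qed.

Lemma edge_ratioS k t : 0 < edge_ratio k.+1 t -> edge_ratio k t = 1.
Proof.
rewrite /edge_ratio; set a := 1 - _.
rewrite lt_max ltxx/= lt_min ltr01/= exprS => h.
by rewrite min_l ?max_r//; lra.
Qed.

Lemma edge_ratio_le k t s : t <= s -> edge_ratio k t <= edge_ratio k s.
Proof.
move=> ts; rewrite /edge_ratio; set a := Num.max 0 t; set b := Num.max 0 s.
have ab : a <= b by rewrite /a /b ge_max !le_max lexx ts orbT.
rewrite ge_max !le_max lexx/=; apply/orP; right.
rewrite le_min ge_min lexx/= ge_min; apply/orP; right.
by rewrite lerD2l lerN2 ler_wpM2l ?exprn_ge0// lerD2l lerN2.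
Qed.

Lemma edge_ratio_continuous k : continuous (edge_ratio k : R -> R).
Proof.
have max0 (f : R -> R) t : {for t, continuous f} ->
    {for t, continuous (fun t => Num.max 0 (f t))}.
  by move=> cf; apply: (@continuous_max _ _ (fun=> 0) f) => //; exact: cvg_cst.
move=> t; apply: (max0 (fun t => Num.min 1 (2 - 2 ^+ k * (1 - Num.max 0 t)))).
apply: (@continuous_min _ _ (fun=> 1)
  (fun t => 2 - 2 ^+ k * (1 - Num.max 0 t))); first exact: cvg_cst.
apply: (@cvgB _ R^o); first exact: cvg_cst.
apply: (@cvgM R); first exact: cvg_cst.
apply: (@cvgB _ R^o); first exact: cvg_cst.
exact: (max0 id t).
Qed.

Lemma edge_ratio_lt t s : 0 <= t -> t < s -> s <= 1 ->
  exists k, edge_ratio k t < edge_ratio k s.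
Proof.
move=> t0 ts s1.
(* The least such [k] is the depth of the edge whose range of heights, top excluded, contains [t];
   there [edge_ratio k] increases strictly to the right of [t]. *)
have [k kt kmin] : exists2 k, 1 < 2 ^+ k * (1 - t) &
    forall j, (j < k)%N -> 2 ^+ j * (1 - t) <= 1.
  have ex : exists k, 1 < 2 ^+ k * (1 - t).
    have [|m] := @exists_expn_lt R (1 - t); first lra.
    by rewrite -div1r ltr_pdivrMr ?exprn_gt0// mulrC => ?; exists m.
  case: (ex_minnP ex) => k kt kmin; exists k => // j jk.
  by rewrite leNgt; apply/negP => /kmin; rewrite leqNgt jk.
case: k kt kmin => [|k] kt kmin; first by move: kt; rewrite expr0; lra.
exists k.+1; have := kmin k (ltnSn k); rewrite /edge_ratio.
rewrite (max_r t0) (max_r (le_trans t0 (ltW ts))).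
move: kt; rewrite exprS; set p := 2 ^+ k => kt kp.
have p0 : 0 < p by rewrite exprn_gt0.
rewrite (@min_r _ _ 1 (2 - 2 * p * (1 - t))); last lra.
rewrite (@max_r _ _ _ (2 - 2 * p * (1 - t))); last lra.
rewrite lt_max lt_min; apply/orP; right; apply/andP; split; first lra.
nra.
Qed.

Lemma branch_proof x t : tree_point
  (fun u => if u == mkseq x (size u) then edge_ratio (size u) t else 0).
Proof.
split=> [|u|u b|u] /=.
- exact: edge_ratio0.
- by case: ifP => _; [exact: edge_ratio_bounds|rewrite lexx ler01].
- rewrite size_rcons mkseqS eqseq_rcons.
  case: eqP => _; last by rewrite mul0r.
  case: eqP => _ /=; last by rewrite mul0r.
  have /andP[] := edge_ratio_bounds (size u).+1 t.
  rewrite le_eqVlt => /predU1P[<- _|/edge_ratioS-> _]; first by rewrite mul0r.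
  by rewrite subrr mulr0.
- rewrite !size_rcons !mkseqS !eqseq_rcons.
  by case: (x (size u)); rewrite /= !(andbF, mulr0, mul0r).
Qed.

(* Height 1 is the end x of the tree; heights below 0 are sent to the root and
   heights above 1 to the end. *)
Definition branch x t : tree R := Tree (branch_proof x t).

Lemma branchE x t u :
  branch x t u = if u == mkseq x (size u) then edge_ratio (size u) t else 0.
Proof. by []. Qed.

Lemma branch_mkseq x t k : branch x t (mkseq x k) = edge_ratio k t.
Proof. by rewrite branchE size_mkseq eqxx. Qed.

Lemma branch_continuous x : continuous (branch x).
Proof.
apply: tree_continuous => u.
have -> : (fun t => branch x t u : R) =
    if u == mkseq x (size u) then edge_ratio (size u) else fun=> 0.
  by apply/funext => t; rewrite /branch /=; case: ifP.
by case: ifP => _ t; [exact: edge_ratio_continuous|exact: cvg_cst].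
Qed.

Lemma branch_le x t s : t <= s -> forall u, branch x t u <= branch x s u.
Proof.
by move=> ts u; rewrite !branchE; case: ifP => // _; exact: edge_ratio_le.
Qed.

Lemma branch_surj c : exists x t, 0 <= t <= 1 /\ c = branch x t.
Proof.
(* Follow from the root the edges that [c] enters, taking [false] where [c] does not enter the edge
   [true]. Every word with a positive coordinate is then a prefix of [x]. *)
pose P := fix P n := if n is m.+1 then rcons (P m) (0 < c (rcons (P m) true))
                     else [::].
pose x n := 0 < c (rcons (P n) true).
have Px n : P n = mkseq x n by elim: n => // n IH; rewrite mkseqS -IH.
have suppP u : 0 < c u -> u = mkseq x (size u).
  elim/last_ind: u => [//|u b IH] cu.
  have eu : u = mkseq x (size u) by apply: IH; rewrite (coord_rcons cu).
  rewrite size_rcons mkseqS -eu; congr rcons; rewrite /x Px -eu.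
  case: b cu => [->//|cu].
  by have /= -> := coord_sibling cu; rewrite ltxx.
pose a k := c (mkseq x k).
have aS k : 0 < a k.+1 -> a k = 1 by rewrite /a mkseqS; exact: coord_rcons.
have a0 k : 0 <= a k := coord_ge0 _ _.
have a1 k : a k <= 1 := coord_le1 _ _.
suff [t t01 ht] : exists2 t, 0 <= t <= 1 & forall k, a k = edge_ratio k t.
  exists x, t; split=> //; apply: tree_eqP => u; rewrite branchE.
  case: eqP => [e|/eqP e]; first by rewrite -ht /a -e.
  apply/eqP; rewrite eq_le coord_ge0 andbT leNgt; apply: contra e.
  by move=> /suppP/eqP.
have [all1|/existsNP ex] := pselect (forall k, a k = 1).
  by exists 1 => [|k]; rewrite ?ler01 ?lexx// edge_ratio1.
have {}ex : exists k, a k != 1 by case: ex => k /eqP; exists k.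
case: (ex_minnP ex) => k ak kmin.
have k0 : (0 < k)%N by case: k ak {kmin} => //; rewrite /a /= coord_nil eqxx.
have lt1 : a k < 1 by rewrite lt_neqAle ak a1.
have p0 j : 0 < 2 ^+ j :> R by rewrite exprn_gt0.
have p2 j : 1 <= 2 ^+ j :> R by rewrite exprn_ege1// ler1n.
have k2 : 2 <= 2 ^+ k :> R by rewrite -[leLHS]expr1 ler_eXn2l ?ltr1n.
(* At the first edge [k] that is not fully covered, [t] solves [2 - 2 ^+ k * (1 - t) = a k]. Both
   sides are 1 at smaller depths and 0 at larger ones. *)
pose t := 1 - (2 - a k) / 2 ^+ k.
have tE : 1 - t = (2 - a k) / 2 ^+ k by rewrite /t; lra.
have t01 : 0 <= t <= 1.
  have u1 : (2 - a k) / 2 ^+ k <= 1 by rewrite ler_pdivrMr//; have := a0 k; lra.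
  have u0 : 0 <= (2 - a k) / 2 ^+ k by apply: divr_ge0; [lra|exact: ltW].
  rewrite /t; apply/andP; split; lra.
exists t => // j; rewrite /edge_ratio (@max_r _ _ 0 t); last by case/andP: t01.
rewrite tE; case: (ltngtP j k) => [jk|kj|->].
- have -> : a j = 1.
    by apply/eqP/negPn/negP => /kmin; rewrite leqNgt jk.
  rewrite min_l ?max_r//.
  have e : 2 ^+ k = 2 ^+ j * 2 ^+ (k - j) :> R by rewrite -exprD subnKC// ltnW.
  have : 2 <= 2 ^+ (k - j) :> R by rewrite -[leLHS]expr1 ler_eXn2l ?ltr1n// subn_gt0.
  rewrite e; set q := 2 ^+ (k - j) => q2.
  rewrite invfM mulrCA !mulrA mulfK ?gt_eqF//.
  suff : (2 - a k) / q <= 1 by lra.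
  by rewrite ler_pdivrMr; have := a0 k; lra.
- have -> : a j = 0.
    elim: j kj => // j IH; rewrite ltnS leq_eqVlt => /predU1P[kj|/IH aj0];
      apply/eqP; rewrite eq_le a0 andbT leNgt; apply/negP => /aS.
      by rewrite -kj => /eqP; rewrite (negPf ak).
    by rewrite aj0 => /eqP; rewrite eq_sym oner_eq0.
  rewrite max_l// ge_min; apply/orP; right.
  have e : 2 ^+ j = 2 ^+ k * 2 ^+ (j - k) :> R by rewrite -exprD subnKC// ltnW.
  have : 2 <= 2 ^+ (j - k) :> R by rewrite -[leLHS]expr1 ler_eXn2l ?ltr1n// subn_gt0.
  rewrite e; set q := 2 ^+ (j - k) => q2.
  have -> : 2 ^+ k * q * ((2 - a k) / 2 ^+ k) = q * (2 - a k).
    by field; rewrite gt_eqF.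
  by nra.
- rewrite mulrCA divff ?gt_eqF// mulr1 opprB addrCA subrr addr0.
  by rewrite min_r ?max_r// ltW.
Qed.

Lemma le_branch c y s : 0 <= s <= 1 -> (forall u, c u <= branch y s u) ->
  exists2 t, 0 <= t <= s & c = branch y t.
Proof.
have [x [t [/andP[t0 t1] ->]]] := branch_surj c => /andP[s0 s1] cs.
have e : branch x t = branch y t.
  apply: tree_eqP => u; rewrite !branchE.
  have /andP[] := edge_ratio_bounds (size u) t.
  rewrite le_eqVlt => /predU1P[<- _|h0 _]; first by rewrite !if_same.
  suff -> : mkseq x (size u) = mkseq y (size u) by [].
  have := cs (mkseq x (size u)); rewrite branch_mkseq branchE size_mkseq.
  by case: eqP => // _; rewrite leNgt h0.
rewrite e in cs *; exists t => //; rewrite t0/= leNgt; apply/negP => st.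
have [k] := edge_ratio_lt s0 st t1.
by have := cs (mkseq y k); rewrite !branch_mkseq leNgt => /negPf->.
Qed.

Lemma branch_inj x t s : 0 <= t <= 1 -> 0 <= s <= 1 ->
  branch x t = branch x s -> t = s.
Proof.
move=> /andP[t0 t1] /andP[s0 s1] e; apply/eqP; rewrite eq_le !leNgt.
apply/andP; split; apply/negP => /edge_ratio_lt; [case/(_ s0 t1)|case/(_ t0 s1)] => k;
  by rewrite -!(branch_mkseq x) e ltxx.
Qed.

(** * Segments, connectedness and local connectedness *)

Definition tree_segment (c c' : tree R) : set (tree R) :=
  [set d : tree R | forall u, c u <= d u <= c' u].

(** Points below [branch y s] lie on the same branch by [le_branch], so the segment is the image of
    an interval of heights. *)
Lemma tree_segment_connected (c c' : tree R) :
  (forall u, c u <= c' u) -> connected (tree_segment c c').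
Proof.
have [y [s [s01 ->]]] := branch_surj c' => cs.
have [t0 /andP[t00 t0s] ec] := le_branch s01 cs.
have -> : tree_segment c (branch y s) = branch y @` `[t0, s]%classic.
  apply/seteqP; split=> [d /= dP|_ [t /= /[!in_itv]/= /andP[t0t ts] <-] u].
    have [|t /andP[t_ge0 ts] ed] := @le_branch d y s s01.
      by move=> u; case/andP: (dP u).
    exists t => //; rewrite /= in_itv/= ts andbT leNgt; apply/negP => tt0.
    have [k] := edge_ratio_lt t_ge0 tt0 (le_trans t0s (proj2 (andP s01))).
    rewrite -!(branch_mkseq y) -ed -ec.
    by case/andP: (dP (mkseq y k)); rewrite leNgt => /negPf->.
  by rewrite ec !branch_le.
apply: connected_continuous_connected; first exact: segment_connected.
exact/continuous_subspaceT/branch_continuous.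
Qed.

Lemma meet_proof (c c' : tree R) : tree_point (fun u => Num.min (c u) (c' u)).
Proof.
split=> [|u|u b|u].
- by rewrite !coord_nil minxx.
- by rewrite le_min !coord_ge0 ge_min coord_le1.
- have [|h] := leP (Num.min (c (rcons u b)) (c' (rcons u b))) 0.
    move=> h; suff -> : Num.min (c (rcons u b)) (c' (rcons u b)) = 0.
      by rewrite mul0r.
    by apply/eqP; rewrite eq_le h le_min !coord_ge0.
  move: h; rewrite lt_min => /andP[/coord_rcons-> /coord_rcons->].
  by rewrite minxx subrr mulr0.
- have [_ _ _ /(_ u)/eqP] := treeP c; rewrite mulf_eq0 => /orP[]/eqP->;
    by rewrite [Num.min 0 _]min_l ?coord_ge0// ?mul0r ?mulr0.
Qed.

(** The last common point of the paths from the root to [c] and to [c']. *)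
Definition meet (c c' : tree R) : tree R := Tree (meet_proof c c').

(** The path from [c] to [c'] through their meet has every coordinate between those of [c] and [c'],
    so it stays as close to [c] as [c'] is. The ball is a union of such connected sets through
    [c]. *)
Lemma tree_ball_connected (c : tree R) (e : R) : 0 < e -> connected (ball c e).
Proof.
move=> e0.
pose V (c' : tree R) := tree_segment (meet c c') c `|` tree_segment (meet c c') c'.
have -> : ball c e = \bigcup_(c' in ball c e) V c'.
  apply/seteqP; split=> [c' bc'|d [c' bc' dV]].
    by exists c' => //; right => u /=; rewrite ge_min !lexx orbT.
  rewrite ballEmdist/= in bc' *; apply: le_lt_trans bc'.
  apply/tree_distP => u.
  have /tree_distP/(_ u) := lexx (tree_dist c c').
  apply: le_trans; rewrite ler_wpM2l ?invr_ge0 ?exprn_ge0//.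
  have h : Num.min (c u) (c' u) = c u \/ Num.min (c u) (c' u) = c' u.
    by case: (leP (c u) (c' u)); [left|right].
  have h1 := ge_min (c u) (c u) (c' u); have h2 := ge_min (c' u) (c u) (c' u).
  rewrite !lexx ?orbT /= in h1 h2.
  have := ler_norm (c u - c' u); have := lerNnormlW (lexx `|c u - c' u|).
  case: dV => /(_ u)/= /andP[d1 d2]; case: h => e1; rewrite e1 in d1 h1 h2 => *; rewrite ler_norml; lra.
apply: bigcup_connected.
  exists c => c' _; left => u /=; by rewrite ge_min !lexx.
move=> c' _; apply: connectedU; last 2 first.
- by apply: tree_segment_connected => u /=; rewrite ge_min lexx.
- by apply: tree_segment_connected => u /=; rewrite ge_min lexx orbT.
by exists (meet c c'); split=> u /=; rewrite lexx /= ge_min lexx ?orbT.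
Qed.

Lemma tree_locally_connected : Defs.locally_connected (tree R).
Proof.
move=> c U; rewrite -filter_from_ballE => -[e /= e0 eU].
exists (ball c e); split=> //; [exact: metric_ball_open|exact: tree_ball_connected|exact: ballxx].
Qed.

Lemma tree_connected : connected [set: tree R].
Proof.
have -> : [set: tree R] = ball (branch (fun=> true) 0) 2.
  apply/seteqP; split=> // c _; rewrite ballEmdist/= (@le_lt_trans _ _ 1)//.
    apply/tree_distP => u.
    rewrite mulr_ile1// ?coord_dist_le1 ?invr_ge0 ?exprn_ge0//.
    by rewrite invf_le1 ?exprn_gt0// exprn_ege1// ler1n.
  by rewrite ltr1n.
exact: tree_ball_connected.
Qed.

Lemma tree_continuum : continuum (tree R).
Proof.
split; [by exists (branch (fun=> true) 0)|exact: tree_compact|exact: tree_connected].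
Qed.

End branch.

(** * Subspaces, arcs and the circle *)

Section subspaces.

Definition to_set (T : Type) (A : set T) (x : T) (Ax : A x) : A :=
  exist _ x (mem_set Ax).

Lemma continuous_set_val (X : topologicalType) (A : set X) :
  continuous (fun a : A => \val a : X).
Proof. exact: initial_continuous. Qed.

Lemma continuous_to_set (X Y : topologicalType) (A : set X) (f : Y -> A) :
  continuous (fun y => \val (f y) : X) -> continuous f.
Proof. by move=> h; exact: (@continuous_comp_initial _ _ _ set_val f). Qed.

(* The inverse is continuous because g maps closed sets to compact, hence closed,
   sets. *)
Lemma homeo_range (K Y : topologicalType) (g : K -> Y) :
  compact [set: K] -> hausdorff_space Y -> continuous g -> injective g ->
  exists (f : range g -> K) (h : K -> range g),
    homeo_pair f h /\ forall k, \val (h k) = g k.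
Proof.
move=> cK hY cg ig.
pose h (k : K) : range g := @to_set _ (range g) (g k) (ex_intro2 _ _ k I erefl).
have /choice[f fP] : forall y : range g, exists k, g k = \val y.
  by move=> y; have [k _ gk] := set_valP y; exists k.
exists f, h; split=> //; split.
- apply/continuous_closedP => C cC.
  have -> : f @^-1` C = (fun y : range g => \val y : Y) @^-1` (g @` C).
    apply/seteqP; split=> y /=; first by exists (f y).
    by move=> [k Ck gk]; rewrite (_ : f y = k)//; apply: ig; rewrite fP.
  have /continuous_closedP : continuous (fun y : range g => \val y : Y).
    exact: continuous_set_val.
  apply; apply: (compact_closed hY); apply: continuous_compact.
    exact: continuous_subspaceT.
  exact: subclosed_compact cC cK _.
- exact: continuous_to_set.
- by move=> y; apply: val_inj; rewrite /= fP.
- by move=> k; apply: ig; rewrite fP.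
Qed.

Section unit_interval.
Context {R : realType}.

Lemma clamp_proof (t : R) : unit_interval (Num.max 0 (Num.min 1 t) : R).
Proof. by rewrite /unit_interval/= in_itv/= le_max lexx ge_max ler01 ge_min lexx. Qed.

Definition clamp (t : R) : unit_interval (R:=R) := to_set (clamp_proof t).

Lemma clampK t : 0 <= t <= 1 -> \val (clamp t) = t.
Proof. by move=> /andP[t0 t1]; rewrite /= min_r// max_r. Qed.

Lemma unit_intervalP (t : unit_interval (R:=R)) : 0 <= \val t <= 1.
Proof. by have := set_valP t; rewrite /unit_interval/= in_itv. Qed.

Lemma clamp_val t : clamp (\val t) = t.
Proof. by apply: val_inj; exact: clampK (unit_intervalP t). Qed.

Lemma clamp_continuous : continuous clamp.
Proof.
apply: continuous_to_set => t /=.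
apply: (@continuous_max R R (fun=> 0) (fun t => Num.min 1 t)).
  exact: cvg_cst.
by apply: (@continuous_min R R (fun=> 1) id); [exact: cvg_cst|exact: cvg_id].
Qed.

Lemma unit_intervalT :
  [set: unit_interval (R:=R)] = clamp @` `[0, 1]%classic.
Proof.
apply/seteqP; split=> // t _; exists (\val t); last exact: clamp_val.
by rewrite /= in_itv/= unit_intervalP.
Qed.

Lemma unit_interval_compact : compact [set: unit_interval (R:=R)].
Proof.
rewrite unit_intervalT; apply: continuous_compact; last exact: segment_compact.
exact/continuous_subspaceT/clamp_continuous.
Qed.

Lemma unit_interval_connected : connected [set: unit_interval (R:=R)].
Proof.
rewrite unit_intervalT; apply: connected_continuous_connected.
  exact: segment_connected.
exact/continuous_subspaceT/clamp_continuous.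
Qed.

End unit_interval.

Section arcs.
Context {R : realType} {X : metricType R}.

Lemma arc_betweenP (A : set X) (v w : X) : arc_between A v w ->
  [/\ A v, A w, v <> w & connected A].
Proof.
move=> [f [g [[cf cg fK gK] g0 g1]]].
have v0 : \val (g (clamp 0)) = v by apply: g0; rewrite clampK// lexx ler01.
have w1 : \val (g (clamp 1)) = w by apply: g1; rewrite clampK// lexx ler01.
split.
- by rewrite -v0; exact: set_valP.
- by rewrite -w1; exact: set_valP.
- rewrite -v0 -w1 => /val_inj/(can_inj gK)/(congr1 \val).
  by rewrite !clampK ?lexx ?ler01// => /eqP; rewrite eq_sym oner_eq0.
- have -> : A = (fun t => \val (g t)) @` setT.
    apply/seteqP; split=> [x Ax|_ [t _ <-]]; last exact: set_valP.
    by exists (f (to_set Ax)) => //; rewrite fK.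
  apply: connected_continuous_connected unit_interval_connected _.
  apply/continuous_subspaceT => t.
  exact: (continuous_comp (cg t) (@continuous_set_val _ _ _)).
Qed.

Lemma arc_between_range (g : R -> X) : continuous g ->
  (forall s t, 0 <= s <= 1 -> 0 <= t <= 1 -> g s = g t -> s = t) ->
  arc_between (range (fun t : unit_interval (R:=R) => g (\val t))) (g 0) (g 1).
Proof.
move=> cg ig.
have [|||f [h [fh hE]]] :=
  @homeo_range _ X (fun t : unit_interval (R:=R) => g (\val t)) unit_interval_compact.
- exact: metric_hausdorff.
- move=> t; apply: (continuous_comp _ (cg _)); exact: continuous_set_val.
- by move=> s t /ig => /(_ (unit_intervalP s) (unit_intervalP t))/val_inj.
- by exists f, h; split=> // t t01; rewrite hE t01.
Qed.

End arcs.

Section circle.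
Context {R : realType}.
Notation circle := (unit_circle (R:=R)).

Lemma stereo_proof (q : circle) (t : R) : circle
  (((\val q).1 * (t ^+ 2 - 1) - (\val q).2 * (2 * t)) / (t ^+ 2 + 1),
   ((\val q).2 * (t ^+ 2 - 1) + (\val q).1 * (2 * t)) / (t ^+ 2 + 1)).
Proof.
have := set_valP q; case: (\val q) => a b; rewrite /unit_circle/= => ab.
have t1 : t ^+ 2 + 1 != 0 by rewrite gt_eqF// ltr_wpDl// sqr_ge0.
rewrite !expr_div_n -mulrDl.
rewrite [X in X / _ = _](_ : _ = (a ^+ 2 + b ^+ 2) * (t ^+ 2 + 1) ^+ 2); last by ring.
by rewrite ab mul1r divff// expf_neq0.
Qed.

(* The inverse of the stereographic projection from q. *)
Definition stereo (q : circle) (t : R) : circle := to_set (stereo_proof q t).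

Lemma stereo_continuous q : continuous (stereo q).
Proof.
apply: continuous_to_set => t.
have t1 : t ^+ 2 + 1 != 0 by rewrite gt_eqF// ltr_wpDl// sqr_ge0.
have csqr : (fun s : R => s ^+ 2) @ t --> t ^+ 2 by exact: exprn_continuous.
have cden : (fun s : R => (s ^+ 2 + 1)^-1) @ t --> (t ^+ 2 + 1)^-1.
  by apply: cvgV => //; apply: (@cvgD _ R^o) => //; exact: cvg_cst.
have clin : (fun s : R => 2 * s) @ t --> 2 * t.
  by apply: (@cvgM R); [exact: cvg_cst|exact: cvg_id].
have cnum : (fun s : R => s ^+ 2 - 1) @ t --> t ^+ 2 - 1.
  by apply: (@cvgB _ R^o) => //; exact: cvg_cst.
pose f (s : R) := ((\val q).1 * (s ^+ 2 - 1) - (\val q).2 * (2 * s)) / (s ^+ 2 + 1).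
pose g (s : R) := ((\val q).2 * (s ^+ 2 - 1) + (\val q).1 * (2 * s)) / (s ^+ 2 + 1).
have cf : f @ t --> f t.
  apply: (@cvgM R) => //; apply: (@cvgB _ R^o); apply: (@cvgM R) => //;
    exact: cvg_cst.
have cg : g @ t --> g t.
  apply: (@cvgM R) => //; apply: (@cvgD _ R^o); apply: (@cvgM R) => //;
    exact: cvg_cst.
exact: (cvg_pair cf cg).
Qed.

Lemma stereo_neq q t : stereo q t <> q.
Proof.
have : circle (sval q) := set_valP q.
move=> + /(congr1 \val) /=; case: (sval q) => a b; rewrite /unit_circle/= => ab [].
have t1 : t ^+ 2 + 1 != 0 by rewrite gt_eqF// ltr_wpDl// sqr_ge0.
move=> /(canRL (mulfVK t1)) e1 /(canRL (mulfVK t1)) e2.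
have e3 : a + b * t = 0 by lra.
have e4 : b - a * t = 0 by lra.
have : a ^+ 2 + b ^+ 2 = a * (a + b * t) + b * (b - a * t) by ring.
by rewrite ab e3 e4 !mulr0 addr0 => /eqP; rewrite oner_eq0.
Qed.

Lemma stereo_surj q z : z <> q -> exists t, stereo q t = z.
Proof.
move=> zq.
have : circle (sval q) := set_valP q; have : circle (sval z) := set_valP z.
have : sval z <> sval q by move/val_inj.
rewrite /unit_circle.
case ez : (sval z) => [z1 z2]; case eq : (sval q) => [a b] /= zab zc ab.
(* In the orthonormal frame with first axis [q], the point [z] is [(x, y)], and its stereographic
   parameter is [y / (1 - x)]. *)
pose x := a * z1 + b * z2; pose y := a * z2 - b * z1.
have xy : x ^+ 2 + y ^+ 2 = 1.
  rewrite /x /y; transitivity ((a ^+ 2 + b ^+ 2) * (z1 ^+ 2 + z2 ^+ 2)); first by ring.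
  by rewrite ab zc mulr1.
have ez1 : z1 = a * x - b * y.
  by rewrite /x /y -[LHS]mul1r -ab; ring.
have ez2 : z2 = b * x + a * y.
  by rewrite /x /y -[LHS]mul1r -ab; ring.
have x1 : 1 - x != 0.
  rewrite subr_eq0 eq_sym; apply/eqP => x1; apply: zab.
  have /eqP : y ^+ 2 = 0 by move: xy; rewrite x1; lra.
  by rewrite sqrf_eq0 => /eqP y0; rewrite ez1 ez2 x1 y0; congr pair; ring.
have t1 : y ^+ 2 + (1 - x) ^+ 2 != 0.
  by rewrite gt_eqF// ltr_wpDl ?sqr_ge0// exprn_even_gt0.
exists (y / (1 - x)); apply: val_inj; rewrite /= eq; change (\val z) with (sval z); rewrite ez /=.
have den : (y / (1 - x)) ^+ 2 + 1 = 2 / (1 - x).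
  have -> : (y / (1 - x)) ^+ 2 + 1 = (x ^+ 2 + y ^+ 2 + 1 - 2 * x) / (1 - x) ^+ 2.
    by field.
  by rewrite xy; field.
have num : (y / (1 - x)) ^+ 2 - 1 = 2 * x / (1 - x).
  have -> : (y / (1 - x)) ^+ 2 - 1 = (x ^+ 2 + y ^+ 2 + 2 * x - 2 * x ^+ 2 - 1) / (1 - x) ^+ 2.
    by field.
  by rewrite xy; field.
rewrite den num ez1 ez2; congr pair; field; rewrite x1 //=.
Qed.

(** The circle minus [q] is a line through [stereo q], so intermediate values are attained away from
    [q]. *)
Lemma circle_IVT (k : circle -> R) (q z w : circle) (s : R) : continuous k ->
  z <> q -> w <> q -> k z <= s <= k w -> exists2 p, p <> q & k p = s.
Proof.
move=> ck /stereo_surj[t tz] /stereo_surj[u uw] /andP[zs sw].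
have cf : continuous (k \o stereo q).
  by move=> r; apply: continuous_comp; [exact: stereo_continuous|exact: ck].
have [tu|/ltW ut] := leP t u.
  have [||r _ rs] := @IVT R (k \o stereo q) t u s tu.
  - exact: continuous_subspaceT.
  - by rewrite /= tz uw ge_min zs le_max sw orbT.
  - by exists (stereo q r) => //; exact: stereo_neq.
have [||r _ rs] := @IVT R (k \o stereo q) u t s ut.
- exact: continuous_subspaceT.
- by rewrite /= tz uw ge_min zs le_max sw orbT.
- by exists (stereo q r) => //; exact: stereo_neq.
Qed.

End circle.

End subspaces.

Lemma take_mkseq (T : Type) (f : nat -> T) m n : (m <= n)%N ->
  take m (mkseq f n) = mkseq f m.
Proof. by move=> mn; rewrite /mkseq -map_take take_iota (minn_idPl mn). Qed.

(** * The tree is the Gehman dendrite: circles, orders of points, endpoints *)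

Section gehman.
Context {R : realType}.
Implicit Types (x y : nat -> bool) (c v w : tree R).

Lemma coord_comparable v u u' : 0 < v u -> 0 < v u' -> (size u <= size u')%N ->
  u = take (size u) u'.
Proof.
have [x [t [_ ->]]] := branch_surj v; rewrite !branchE.
case: eqP => [eu _|_]; last by rewrite ltxx.
case: eqP => [eu' _|_]; last by rewrite ltxx.
by move=> h; rewrite {1}eu [in RHS]eu' take_mkseq.
Qed.

Lemma coord_take v u k : 0 < v u -> (k < size u)%N -> v (take k u) = 1.
Proof.
elim/last_ind: u => // u b IH vu; rewrite size_rcons ltnS leq_eqVlt.
have vu1 := coord_rcons vu; move=> /predU1P[->|ku].
  by rewrite -cats1 take_size_cat.
by rewrite -cats1 takel_cat ?(ltnW ku)// IH// vu1.
Qed.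

Lemma coord_unique c c' u : 0 < c u < 1 -> c' u = c u -> c' = c.
Proof.
have [x [t [t01 ->]]] := branch_surj c; have [y [s [s01 ->]]] := branch_surj c'.
rewrite !branchE; case: eqP => [eu|_]; last by rewrite ltxx.
set k := size u; move=> /andP[t0 t1]; case: eqP => [eu'|_]; last first.
  by move=> e; rewrite -e ltxx in t0.
have pos i j r : (i < j)%N -> 0 < edge_ratio j r -> edge_ratio i r = 1 :> R.
  elim: j => // j IH; rewrite ltnS leq_eqVlt => /predU1P[->|ij] /edge_ratioS//.
  by move=> e; apply: IH => //; rewrite e.
have neq r r' : 0 <= r -> r' <= 1 -> 0 < edge_ratio k r < 1 ->
    edge_ratio k r' = edge_ratio k r -> ~ (r < r' :> R).
  move=> r0 r1 /andP[h0 h1] e /edge_ratio_lt => /(_ r0 r1)[j jr].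
  case: (ltngtP j k) => [jk|kj|jk]; last by rewrite jk e ltxx in jr.
    have := pos _ _ _ jk h0; have /andP[_] := edge_ratio_bounds j r'; lra.
  have j0 : 0 < edge_ratio j r'.
    by rewrite (le_lt_trans _ jr)//; case/andP: (edge_ratio_bounds j r).
  by have := pos _ _ _ kj j0; lra.
move=> e; case/andP: t01 => t00 t11; case/andP: s01 => s00 s11.
have -> : s = t.
  apply/eqP; rewrite eq_le !leNgt; apply/andP; split; apply/negP.
    by apply: neq => //; rewrite t0.
  by apply: neq => //; rewrite e t0.
apply: tree_eqP => w; rewrite !branchE.
have [wk|kw] := leqP (size w) k.
  suff -> : mkseq x (size w) = mkseq y (size w) by [].
  by rewrite -(take_mkseq x wk) -(take_mkseq y wk) -eu -eu'.
suff -> : edge_ratio (size w) t = 0 by rewrite !if_same.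
have /andP[] := edge_ratio_bounds (size w) t.
rewrite le_eqVlt => /predU1P[//|/(pos _ _ _ kw)]; lra.
Qed.

(** Two points of a circle differ in some coordinate [u]. An intermediate value is attained at a
    point [p] and, since the circle minus [p] is still connected, at a second point, against
    [coord_unique]. *)
Lemma tree_no_circle (A : set (tree R)) : ~ simple_closed_curve A.
Proof.
move=> [F [G [cF cG FK GK]]].
have on1 : unit_circle (R:=R) (1, 0) by rewrite /unit_circle/=; ring.
have on2 : unit_circle (R:=R) (- 1, 0) by rewrite /unit_circle/=; ring.
have on3 : unit_circle (R:=R) (0, 1) by rewrite /unit_circle/=; ring.
pose z := to_set on1; pose w := to_set on2; pose q := to_set on3.
have zw : z <> w by move/(congr1 \val) => /= []; lra.
have zq : z <> q by move/(congr1 \val) => /= []; lra.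
have wq : w <> q by move/(congr1 \val) => /= []; lra.
pose k u (p : unit_circle (R:=R)) := (\val (G p) : tree R) u.
have ck u : continuous (k u).
  move=> p; have cv := continuous_comp (cG p) (@continuous_set_val _ A (G p)).
  exact: (continuous_comp cv (@tree_coord_continuous R u _)).
have main u (z' w' q' : unit_circle (R:=R)) : z' <> q' -> w' <> q' -> k u z' < k u w' -> False.
  move=> zq' wq' lt; pose s := (k u z' + k u w') / 2.
  have zs : k u z' < s by rewrite /s; lra.
  have sw : s < k u w' by rewrite /s; lra.
  have [|p _ ps] := @circle_IVT R (k u) q' z' w' s (ck u) zq' wq'.
    by rewrite !ltW.
  have [|||p' pp' ps'] := @circle_IVT R (k u) p z' w' s (ck u).
  - by move=> e; move: zs; rewrite e ps ltxx.
  - by move=> e; move: sw; rewrite e ps ltxx.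
  - by rewrite !ltW.
  apply: pp'; apply: (can_inj GK); apply: val_inj.
  apply: (@coord_unique _ _ u); last by rewrite -[LHS]/(k u p') ps' -ps.
  rewrite -[_ u]/(k u p) ps (le_lt_trans _ zs) ?coord_ge0//=.
  by rewrite (lt_le_trans sw) ?coord_le1.
have [/tree_eqP e|/existsNP[u /eqP]] := pselect (forall u, k u z = k u w).
  by apply: zw; apply: (can_inj GK); exact: val_inj.
rewrite neq_lt => /orP[]; [exact: main zq wq|exact: main wq zq].
Qed.

Lemma tree_dendrite : dendrite (tree R).
Proof.
by split; [exact: tree_continuum|exact: tree_locally_connected|exact: tree_no_circle].
Qed.

Lemma coord_between (A : set (tree R)) v w u (s : R) : connected A -> A v -> A w ->
  v u <= s <= w u -> exists2 p, A p & p u = s.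
Proof.
move=> cA Av Aw vsw.
have : connected ((fun c : tree R => c u : R) @` A).
  apply: connected_continuous_connected => //.
  exact/continuous_subspaceT/tree_coord_continuous.
move=> /connected_intervalP iA.
have [||p Ap ps] := iA (v u) (w u) _ _ s vsw; [by exists v|by exists w|].
by exists p.
Qed.

(* The directions at v: None leads to the root, Some b to the subtree above v
   that starts with the letter b. *)
Definition direction v w (d : option bool) : Prop :=
  if d is Some b then
    (forall u, v u <= w u) /\
    exists2 p, v p = 1 & v (rcons p b) < w (rcons p b)
  else exists u, w u < v u.

Lemma exists_direction v w : v <> w -> exists d, direction v w d.
Proof.
move=> vw; have [h|/existsNP[u /negP]] := pselect (forall u, v u <= w u); last first.
  by rewrite -ltNge => wv; exists None, u.
have [u uvw] : exists u, v u < w u.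
  apply: contrapT => /forallNP h'; apply: vw; apply: tree_eqP => u.
  by apply/eqP; rewrite eq_le h leNgt; apply/negP/h'.
suff [p [b [vp vw']]] : exists p b, v p = 1 /\ v (rcons p b) < w (rcons p b).
  by exists (Some b); split=> //; exists p.
(* Go down edge by edge until [v] covers the preceding edge [u]: where it does not, [w] does cover
   [u], so [v] falls short of [w] there already. *)
elim/last_ind: u uvw => [|u b IH] uvw; first by rewrite !coord_nil ltxx in uvw.
have [vu|vu] := eqVneq (v u) 1; first by exists u, b.
apply: IH; rewrite lt_neqAle h andbT; apply: contra vu => /eqP->.
by apply/eqP; apply: coord_rcons (le_lt_trans (coord_ge0 _ _) uvw).
Qed.

(** Provides one coordinate along which both arcs leaving [v] in this direction have to move the
    same way. *)
Lemma same_direction v w w' d : direction v w d -> direction v w' d ->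
  exists u, (v u < w u /\ v u < w' u) \/ (w u < v u /\ w' u < v u).
Proof.
case: d => [b [vw [p vp pw]] [vw' [p' vp' pw']]|[u wu] [u' wu']].
(* Upwards the two words coincide. If [p1] were a proper prefix of [p2], then [v] would cover the
   edge following [p1] in [p2]: this is not edge [b], where [v] is below [w1], nor its sibling,
   which [w1] would have to cover too. *)
- have step w1 w2 p1 p2 : (forall u, v u <= w1 u) -> v p1 = 1 -> v p2 = 1 ->
      v (rcons p1 b) < w1 (rcons p1 b) -> v (rcons p2 b) < w2 (rcons p2 b) ->
      (size p1 <= size p2)%N ->
      v (rcons p1 b) < w1 (rcons p1 b) /\ v (rcons p1 b) < w2 (rcons p1 b).
    move=> vw1 vp1 vp2 h1 h2 le12; split=> //.
    have p1E : p1 = take (size p1) p2 by apply: (@coord_comparable v); rewrite ?vp1 ?vp2.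
    move: le12; rewrite leq_eqVlt => /predU1P[e|lt12].
      by rewrite p1E e take_size.
    exfalso; pose b' := nth true p2 (size p1).
    have e : take (size p1).+1 p2 = rcons p1 b'.
      by rewrite (take_nth true)// -p1E.
    have v1 : v (rcons p1 b') = 1.
      rewrite -e; move: lt12; rewrite leq_eqVlt => /predU1P[->|lt12].
        by rewrite take_size.
      by apply: coord_take => //; rewrite vp2.
    have [bb|bb] := eqVneq b' b.
      by move: h1; rewrite -bb v1 ltNge coord_le1.
    have e' : b' = ~~ b by move: bb; case: (b') (b) => [] [].
    have := vw1 (rcons p1 b'); rewrite v1 e' coord_sibling ?ler10//.
    exact: le_lt_trans (coord_ge0 _ _) h1.
  have [le|/ltnW le] := leqP (size p) (size p').
    by exists (rcons p b); left; apply: (step w w' p p').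
  by exists (rcons p' b); left; rewrite and_comm; apply: (step w' w p' p).
(* Towards the root the longer word works: a path that covers less of the edge [u1] than [v] does
   not reach a longer [u2] at all. *)
- have step w1 w2 u1 u2 : w1 u1 < v u1 -> w2 u2 < v u2 ->
      (size u1 <= size u2)%N -> w1 u2 < v u2 /\ w2 u2 < v u2.
    move=> h1 h2 le12; split=> //.
    have v1 : 0 < v u1 by rewrite (le_lt_trans (coord_ge0 _ _) h1).
    have v2 : 0 < v u2 by rewrite (le_lt_trans (coord_ge0 _ _) h2).
    have u1E : u1 = take (size u1) u2 by exact: (coord_comparable v1 v2 le12).
    move: le12; rewrite leq_eqVlt => /predU1P[e|lt12].
      by rewrite e take_size in u1E; rewrite -u1E.
    suff -> : w1 u2 = 0 by [].
    apply/eqP; rewrite eq_le coord_ge0 andbT leNgt; apply/negP => w12.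
    by move: h1; rewrite u1E (coord_take w12 lt12) ltNge coord_le1.
  have [le|/ltnW le] := leqP (size u) (size u').
    by exists u'; right; apply: (step w w' u u').
  by exists u; right; rewrite and_comm; apply: (step w' w u' u).
Qed.

(** By connectedness both arcs attain a common value strictly between that of [v] and those of [w]
    and [w']. It lies strictly between 0 and 1, so [coord_unique] makes it one common point,
    different from [v]. *)
Lemma arcs_same_direction v w w' d (A A' : set (tree R)) :
  arc_between A v w -> arc_between A' v w' ->
  direction v w d -> direction v w' d -> A `&` A' <> [set v].
Proof.
move=> /arc_betweenP[Av Aw _ cA] /arc_betweenP[A'v A'w _ cA'] dw dw' e.
have [u h] := same_direction dw dw'.
suff [s [s0 s1 vs [p Ap ps] [p' A'p p's]]] : exists s : R, [/\ 0 < s, s < 1, v u <> s,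
    exists2 p, A p & p u = s & exists2 p, A' p & p u = s].
  have pp' : p' = p by apply: (@coord_unique _ _ u); rewrite ?ps ?s0.
  have : (A `&` A') p by split; rewrite // -pp'.
  by rewrite e => pv; apply: vs; rewrite -pv.
have := coord_ge0 v u; have := coord_le1 v u.
have := coord_ge0 w u; have := coord_le1 w u.
have := coord_ge0 w' u; have := coord_le1 w' u.
move=> {e} ? ? ? ? ? ?.
case: h => -[h1 h2].
- pose m := Num.min (w u) (w' u).
  have mP : [/\ m <= w u, m <= w' u & v u < m].
    by rewrite /m lt_min h1 h2 !ge_min !lexx orbT.
  case: mP => m1 m2 m3; exists ((v u + m) / 2); split; try lra.
    by apply: (coord_between cA Av Aw); apply/andP; split; lra.
  by apply: (coord_between cA' A'v A'w); apply/andP; split; lra.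
- pose m := Num.max (w u) (w' u).
  have mP : [/\ w u <= m, w' u <= m & m < v u].
    by rewrite /m gt_max h1 h2 !le_max !lexx orbT.
  case: mP => m1 m2 m3; exists ((v u + m) / 2); split; try lra.
    by apply: (coord_between cA Aw Av); apply/andP; split; lra.
  by apply: (coord_between cA' A'w A'v); apply/andP; split; lra.
Qed.

Lemma star_directions v n : star_at v n ->
  exists d : 'I_n -> option bool,
    injective d /\ forall i, exists w, direction v w (d i).
Proof.
move=> [A [arcA AI]].
have /choice[w wP] : forall i, exists w, arc_between (A i) v w by [].
have /choice[d dP] : forall i, exists d, direction v (w i) d.
  by move=> i; apply: exists_direction; case: (arc_betweenP (wP i)).
exists d; split=> [i j dij|i]; last by exists (w i).
apply/eqP/negPn/negP => /AI; apply: arcs_same_direction (wP i) (wP j) (dP i) _.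
by rewrite dij.
Qed.

Lemma star_le3 v n : star_at v n -> (n <= 3)%N.
Proof.
move=> /star_directions[d [dI _]].
by have := leq_card d dI; rewrite card_ord card_option card_bool.
Qed.

(** Only the direction to the root exists at an end: the next edge along [x] is already covered, and
    a point above the end cannot enter its sibling. *)
Lemma end_star_le1 x n : star_at (branch x 1 : tree R) n -> (n <= 1)%N.
Proof.
move=> /star_directions[d [dI dP]].
have dN i : d i = None.
  have [w] := dP i; case: (d i) => // b [vw [p vp]].
  have ep : p = mkseq x (size p).
    by apply/eqP; move: vp; rewrite branchE; case: eqP => // _ /eqP; rewrite eq_sym oner_eq0.
  have xp : branch x 1 (rcons p (x (size p))) = 1 :> R.
    by rewrite {1}ep -mkseqS branch_mkseq edge_ratio1.
  have [<-|bx] := eqVneq (x (size p)) b; first by rewrite xp ltNge coord_le1.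
  move=> h; have := vw (rcons p (x (size p))); rewrite xp.
  have -> : x (size p) = ~~ b by move: bx; case: (x _) (b) => [] [].
  rewrite coord_sibling ?ler10//; exact: le_lt_trans (coord_ge0 _ _) h.
by case: n d dI {dP} dN => [|[|n]] // d dI dN; have := dI ord0 ord_max; rewrite !dN => /(_ erefl).
Qed.

Definition branch_arc x (a b : R) : set (tree R) :=
  range (fun t : unit_interval (R:=R) => branch x (a + (b - a) * \val t)).

Lemma branch_arcP x (a b : R) : 0 <= a <= 1 -> 0 <= b <= 1 -> a != b ->
  arc_between (branch_arc x a b) (branch x a) (branch x b).
Proof.
move=> /andP[a0 a1] /andP[b0 b1] ab.
have := @arc_between_range R (tree R) (fun t => branch x (a + (b - a) * t)).
rewrite mulr0 addr0 mulr1 subrKC; apply.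
  move=> t; apply: continuous_comp; last exact: branch_continuous.
  apply: (@cvgD _ R^o); first exact: cvg_cst.
  by apply: (@cvgM R); [exact: cvg_cst|exact: cvg_id].
have conv t : 0 <= t <= 1 -> 0 <= a + (b - a) * t <= 1.
  by move=> /andP[? ?]; apply/andP; split; nra.
move=> s t /conv s01 /conv t01 /(branch_inj s01 t01)/addrI/mulfI; apply.
by rewrite subr_eq0 eq_sym.
Qed.

Lemma star_at1 x : star_at (branch x 1 : tree R) 1.
Proof.
exists (fun=> branch_arc x 1 0); split=> [_|i j]; last by rewrite !ord1 eqxx.
by exists (branch x 0); apply: branch_arcP; rewrite ?lexx ?ler01 ?oner_eq0.
Qed.

Lemma star_at2 v w w' (A A' : set (tree R)) :
  arc_between A v w -> arc_between A' v w' -> A `&` A' = [set v] -> star_at v 2.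
Proof.
move=> Aw Aw' AA'; exists (fun i : 'I_2 => if i == ord0 then A else A').
split=> [i|i j]; first by case: ifP => _; [exists w|exists w'].
by case: i j => [[|[|?]] ?] [[|[|?]] ?] //= _; rewrite // setIC.
Qed.

(** At the root the two arcs climb along the two constant sequences; at a positive height they
    descend and climb along the branch of [x]. *)
Lemma star_at_not_end x (t : R) : 0 <= t < 1 -> star_at (branch x t : tree R) 2.
Proof.
move=> /andP[]; rewrite le_eqVlt => /predU1P[<- _|t0 t1].
- have e y : branch y 0 = branch (fun=> true) 0 :> tree R.
    apply: tree_eqP => u; rewrite !branchE; case: u => [//|b u] /=.
    have -> : edge_ratio (size u).+1 0 = 0 :> R.
      rewrite /edge_ratio maxxx subr0 mulr1 max_l// ge_min; apply/orP; right.
      by rewrite subr_le0 exprS ler_peMr ?ler0n// exprn_ege1 ?ler1n.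
    by rewrite !if_same.
  rewrite e; have arc y : arc_between (branch_arc y 0 1) (branch (fun=> true) 0) (branch y 1 : tree R).
    by rewrite -(e y); apply: branch_arcP; rewrite ?lexx ?ler01// eq_sym oner_eq0.
  apply: (star_at2 (arc (fun=> true)) (arc (fun=> false))).
  apply/seteqP; split=> [c [[s _ sc] [s' _ s'c]]|c ->]; last first.
    by split; [case: (arc_betweenP (arc (fun=> true)))|case: (arc_betweenP (arc (fun=> false)))].
  rewrite /= -sc; have /andP[s0 s1] := unit_intervalP s.
  have [->|s_neq0] := eqVneq (\val s) 0; first by rewrite mulr0 addr0.
  have s_gt0 : 0 < \val s by rewrite lt_neqAle eq_sym s_neq0.
  (* The branch of the constant sequence [false] does not enter the edge [true], so [c] has height
     0. *)
  have : c [:: true] = 0 by rewrite -s'c.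
  rewrite -sc branchE eqxx /edge_ratio subr0 mul1r add0r.
  rewrite (@max_r _ _ 0 (\val s))// expr1.
  move/eqP; rewrite eq_le ge_max lexx/= ge_min leNgt ltr01/= => /andP[h _].
  have {}h : 2 - 2 * (1 - \val s) <= 0 := h.
  by exfalso; clear e arc sc s'c; lra.
- have l01 : 0 <= t <= 1 by rewrite !ltW.
  have arc0 : arc_between (branch_arc x t 0) (branch x t) (branch x 0 : tree R).
    by apply: branch_arcP; rewrite ?lexx ?ler01// gt_eqF.
  have arc1 : arc_between (branch_arc x t 1) (branch x t) (branch x 1 : tree R).
    by apply: branch_arcP; rewrite ?lexx ?ler01// lt_eqF.
  apply: (star_at2 arc0 arc1).
  apply/seteqP; split=> [c [[s _ sc] [s' _ s'c]]|c ->]; last first.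
    by split; [case: (arc_betweenP arc0)|case: (arc_betweenP arc1)].
  have /andP[s0 s1] := unit_intervalP s; have /andP[s'0 s'1] := unit_intervalP s'.
  rewrite /= -sc; have : t + (0 - t) * \val s = t + (1 - t) * \val s'.
    by apply: (@branch_inj R x); [clear sc s'c; apply/andP; split; nra|clear sc s'c; apply/andP; split; nra|rewrite sc].
  move=> h; suff -> : t + (0 - t) * \val s = t by [].
  by clear sc s'c; nra.
Qed.

Lemma point_order_ge v n : star_at v n -> ((n%:R)%:E <= point_order v)%E.
Proof. by move=> h; apply: ereal_sup_ubound; exists n. Qed.

Lemma point_order_le v m : (forall n, star_at v n -> (n <= m)%N) ->
  (point_order v <= (m%:R)%:E)%E.
Proof.
move=> h; apply: ge_ereal_sup => _ [n /h nm <-].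
by rewrite lee_fin ler_nat.
Qed.

Lemma endpointP v : endpoint v <-> range (fun x => branch x 1) v.
Proof.
split=> [|[x _ <-]]; last first.
  apply/eqP; rewrite eq_le; apply/andP; split.
    exact: point_order_le (@end_star_le1 x).
  exact: point_order_ge (star_at1 x).
have [x [t [/andP[t0]]]] := branch_surj v.
rewrite le_eqVlt => /predU1P[-> ->|t1 ->]; first by exists x.
rewrite /endpoint => h; have : (2%:E <= point_order (branch x t : tree R))%E.
  by apply: point_order_ge; apply: star_at_not_end; rewrite t0.
by rewrite h lee_fin (ler_nat R 2 1).
Qed.

Lemma end_continuous :
  continuous (fun x : cantor_space => branch x 1 : tree R).
Proof.
apply: tree_continuous => u x; apply: cvg_near_cst.
suff : \forall y \near x, mkseq y (size u) = mkseq x (size u).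
  by apply: filterS => y e; rewrite !branchE e.
elim: (size u) => [|k IH]; first exact: filterE.
have hk : \forall y \near x, y k = x k.
  have /(_ x [set x k]) := @proj_continuous nat (fun=> bool) k.
  by apply; exact: discrete_set1.
by apply: filterS2 hk IH => y e1 e2; rewrite !mkseqS e1 e2.
Qed.

Lemma tree_gehman : gehman_dendrite (tree R).
Proof.
split; first exact: tree_dendrite.
- have -> : [set v : tree R | endpoint v] = range (fun x : cantor_space => branch x 1).
    by apply/seteqP; split=> v /= /endpointP.
  have [|||f [h [fh _]]] :=
      @homeo_range cantor_space (tree R) (fun x => branch x 1) cantor_space_compact.
  + exact: metric_hausdorff.
  + exact: end_continuous.
  + move=> x y e; apply/funext => n.
    have : branch x 1 (mkseq y n.+1) = 1 :> R by rewrite e branch_mkseq edge_ratio1.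
    rewrite branchE size_mkseq; case: eqP => [|_ /eqP]; last by rewrite eq_sym oner_eq0.
    by rewrite !mkseqS => /rcons_inj[_ ->].
  by exists f, h.
- move=> v v3; apply/eqP; rewrite eq_le v3 andbT.
  exact: point_order_le (@star_le3 v).
Qed.

End gehman.

(** * A shift on the binary tree *)

Section entropy_bounds.
Context {R : realType} {X : metricType R} (T : X -> X).

Lemma entropy_at_le0 (e : R) :
  (forall d : R, 0 < d -> exists C : R, forall n,
     (separation_number T n e <= (C * expR (d * n%:R))%:E)%E) ->
  (entropy_at T e <= 0)%E.
Proof.
move=> h; apply/lee_addgt0Pr => d d0; rewrite add0e.
have d20 : 0 < d / 2 by rewrite divr_gt0.
have [C hC] := h _ d20.
(* From [N] on, [ln C1] is at most [d / 2 * n], so the constant costs only the other half of the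
   rate [d]. *)
pose C1 := Num.max 1 C; have C1_gt0 : 0 < C1 by rewrite lt_max ltr01.
pose N := (Num.truncn (ln C1 / (d / 2))).+1.
rewrite /entropy_at /limn_esup /limf_esup.
apply: (@le_trans _ _ (ereal_sup
   ((fun n => (n%:R^-1)%:E * lne (separation_number T n e))%E @` [set n | (N <= n)%N]))).
  apply: ereal_inf_lbound; exists [set n | (N <= n)%N] => //; exact: nbhs_infty_ge.
apply: ge_ereal_sup => _ [n /= Nn <-].
have n0 : (0 < n)%N by exact: leq_trans Nn.
rewrite lee_pdivrMl ?ltr0n//.
have sep0 := separation_number_ge0 T n e.
rewrite (@le_trans _ _ (lne (C1 * expR (d / 2 * n%:R))%:E))//.
  rewrite lee_lne ?in_itv/= ?sep0 ?leey ?lee_fin ?mulr_ge0 ?expR_ge0 ?(ltW C1_gt0)//.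
  by rewrite (le_trans (hC n))// lee_fin ler_pM2r ?expR_gt0// le_max lexx orbT.
rewrite lne_EFin ?mulr_gt0 ?expR_gt0//.
rewrite lnM ?posrE ?expR_gt0// expRK -EFinM lee_fin.
suff : ln C1 <= d / 2 * n%:R by nra.
rewrite mulrC -ler_pdivrMr// (le_trans (ltW (truncnS_gt _)))//.
by rewrite ler_nat.
Qed.

Lemma entropy_at_ge0 (x : X) (e : R) : (0 <= entropy_at T e)%E.
Proof.
apply: le_ereal_inf_tmp => _ [V [N _ NV] <-].
apply: (@le_trans _ _ ((N%:R^-1)%:E * lne (separation_number T N e))%E).
  rewrite mule_ge0 ?lee_fin ?invr_ge0// lne_ge0.
  have := @separated_set_le_separation_number R X T N e [fset x]%fset.
  rewrite cardfs1; apply=> a b; rewrite !in_fset1 => /eqP-> /eqP->.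
  by rewrite eqxx.
by apply: ereal_sup_ubound; exists N => //; apply: NV => /=.
Qed.

Lemma topological_entropy_eq0 (x : X) :
  (forall e : R, 0 < e -> (entropy_at T e <= 0)%E) -> topological_entropy T = 0%E.
Proof.
move=> h; apply/eqP; rewrite eq_le; apply/andP; split.
  by apply: ge_ereal_sup => _ [e /= e0 <-]; exact: h.
rewrite (le_trans (entropy_at_ge0 x 1))//.
by apply: ereal_sup_ubound; exists 1 => /=.
Qed.

(** Two points of a separated set are too far apart to share a code, so the code is injective on
    it. *)
Lemma separation_number_le (F : finType) (code : X -> F) n (e : R) :
  (forall x y, code x = code y -> bowen_dist T n x y <= e) ->
  (separation_number T n e <= (#|F|%:R)%:E)%E.
Proof.
move=> h; apply: ge_ereal_sup => _ [A sA <-]; rewrite lee_fin ler_nat.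
have u : uniq [seq code x | x <- enum_fset A].
  rewrite map_inj_in_uniq ?enum_finmap_uniq ?fset_uniq// => x y xA yA cxy.
  apply/eqP/negPn/negP => /(sA _ _ xA yA).
  by rewrite ltNge h.
by rewrite -(size_map code) -(card_uniqP u) max_card.
Qed.

End entropy_bounds.

(** * The retracted shift: continuity, surjectivity and zero entropy *)

Section tree_shift.
Context {R : realType} (L : pred (seq bool)).
Hypothesis L_rcons : forall u b, L (rcons u b) -> L u.
Implicit Types c : tree R.

Lemma coord_head c b b' u u' : 0 < c (b :: u) -> 0 < c (b' :: u') -> b = b'.
Proof.
move=> h h'; have [le|/ltnW le] := leqP (size (b :: u)) (size (b' :: u')).
  by have [] := coord_comparable h h' le.
by have [] := coord_comparable h' h le.
Qed.

Let image_coord c (u : seq bool) : R :=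
  if u is [::] then 1 else c (true :: u) + (if L u then c (false :: u) else 0).

Let image_ge0 c u : 0 <= image_coord c u.
Proof.
case: u => [|b u] /=; first exact: ler01.
by rewrite addr_ge0 ?coord_ge0//; case: ifP; rewrite ?coord_ge0.
Qed.

Let image_coordE c u : u != [::] -> image_coord c u =
  c (true :: u) + (if L u then c (false :: u) else 0).
Proof. by case: u. Qed.

Let image_coordP c u : u != [::] -> 0 < image_coord c u ->
  exists b, [/\ 0 < c (b :: u), b || L u & image_coord c u = c (b :: u)].
Proof.
move=> u0; rewrite (image_coordE c u0); have := coord_ge0 c (true :: u); rewrite le_eqVlt => /predU1P[<-|ct].
  rewrite add0r; case: ifP => Lu; last by rewrite ltxx.
  by exists false.
suff -> : (if L u then c (false :: u) else 0) = 0.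
  by rewrite addr0 => _; exists true.
case: ifP => // _; apply/eqP; rewrite eq_le coord_ge0 andbT leNgt.
by apply/negP => cf; have := coord_head ct cf.
Qed.

Let image_coord_val c u b : u != [::] -> c (b :: u) = 1 -> b || L u ->
  image_coord c u = 1.
Proof.
move=> u0 cb bL; have ci : 0 < image_coord c u.
  case: u u0 cb bL => // a u _; case: b => /= [->|-> ->] //.
    by rewrite ltr_pwDl//; case: ifP; rewrite ?coord_ge0.
  by rewrite ltr_pwDr ?coord_ge0.
have [b' [cb' _ ->]] := image_coordP u0 ci.
have cb0 : 0 < c (b :: u) by rewrite cb ltr01.
by rewrite -(coord_head cb0 cb').
Qed.

Lemma tree_shift_proof c : tree_point (image_coord c).
Proof.
split=> [//|u|u b|u].
- rewrite image_ge0/=; case: (eqVneq u [::]) => [->//|u0].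
  have := image_ge0 c u; rewrite le_eqVlt => /predU1P[<-|/(image_coordP u0)].
    exact: ler01.
  by case=> b [_ _ ->]; exact: coord_le1.
- case: (eqVneq u [::]) => [->|u0]; first by rewrite subrr mulr0.
  have r0 : rcons u b != [::] by rewrite -size_eq0 size_rcons.
  have := image_ge0 c (rcons u b).
  rewrite le_eqVlt => /predU1P[<-|/(image_coordP r0)]; first by rewrite mul0r.
  case=> a [ca aL _].
  rewrite (@image_coord_val c u a) ?subrr ?mulr0//.
    by move: ca; rewrite -rcons_cons => /coord_rcons.
  by case: a aL {ca} => //= /L_rcons.
- have r0 b : rcons u b != [::] by rewrite -size_eq0 size_rcons.
  have := image_ge0 c (rcons u true).
  rewrite le_eqVlt => /predU1P[<-|/(image_coordP (r0 _))]; first by rewrite mul0r.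
  case=> a [ca _ _].
  have := image_ge0 c (rcons u false).
  rewrite le_eqVlt => /predU1P[<-|/(image_coordP (r0 _))]; first by rewrite mulr0.
  case=> a' [ca' _ _]; move: (ca'); rewrite -(coord_head ca ca').
  by rewrite -rcons_cons (@coord_sibling _ c (a :: u) true) ?rcons_cons// ltxx.
Qed.

(* At most one summand of [image_coord c u] is nonzero: the subtree above true is
   mapped onto the whole tree by deleting the first letter, while the subtree above
   false is in addition retracted onto the subtree spanned by L. *)
Definition tree_shift c : tree R := Tree (tree_shift_proof c).

Lemma tree_shiftE c a u : tree_shift c (a :: u) =
  c (true :: a :: u) + (if L (a :: u) then c (false :: a :: u) else 0).
Proof. by []. Qed.

Lemma tree_shift_continuous : continuous tree_shift.
Proof.
apply: tree_continuous => -[|a u] c.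
  have -> : (fun c => tree_shift c [::] : R) = fun=> 1 by [].
  exact: cst_continuous.
have -> : (fun c => tree_shift c (a :: u) : R) = (fun c => c (true :: a :: u) +
  (if L (a :: u) then c (false :: a :: u) else 0)) by [].
have FF : Filter (nbhs c) by exact: nbhs_filter.
have h1 := @tree_coord_continuous R (true :: a :: u) c.
have h2 : (fun c : tree R => if L (a :: u) then c (false :: a :: u) else 0 : R) @ c -->
    (if L (a :: u) then c (false :: a :: u) else 0 : R).
  by case: ifP => _; [exact: tree_coord_continuous|exact: cvg_cst].
exact: (@cvgD _ R^o _ _ _ _ _ _ _ h1 h2).
Qed.

(** Puts the letter [true] in front of a point, which [tree_shift] deletes again. *)
Let section_coord c (u : seq bool) : R :=
  if u is b :: u' then (if b then c u' else 0) else 1.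

Let section_proof c : tree_point (section_coord c).
Proof.
split=> [//|[|[] u]|[|[] u] b|[|[] u]] /=; rewrite ?lexx ?ler01 ?coord_ge0 ?coord_le1 ?subrr ?mulr0 ?mul0r//.
  by case: (treeP c).
by case: (treeP c).
Qed.

Lemma tree_shift_surj : range tree_shift = [set: tree R].
Proof.
apply/seteqP; split=> // c _; exists (Tree (section_proof c)) => //.
apply: tree_eqP => -[|a u]; first by rewrite !coord_nil.
by rewrite tree_shiftE /=; case: ifP; rewrite addr0.
Qed.

(** All prefixes of the shifted sequence lie in [L], so the retraction leaves its end in place. *)
Lemma tree_shift_branch (x : nat -> bool) :
  (forall k, L (mkseq (x \o succn) k)) ->
  tree_shift (branch x 1) = branch (x \o succn) 1.
Proof.
move=> Lx; apply: tree_eqP => -[|a u]; first by rewrite !coord_nil.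
have mk b : branch x 1 (b :: a :: u) =
    if (b == x 0%N) && (a :: u == mkseq (x \o succn) (size u).+1) then 1 else 0 :> R.
  rewrite branchE /= edge_ratio1 /mkseq /= !eqseq_cons; congr (if _ && (_ && (_ == _)) then _ else _).
  by rewrite -[2%N]/(1 + 1)%N iotaDl -map_comp.
rewrite tree_shiftE !mk branchE edge_ratio1 -[size (a :: u)]/(size u).+1.
case: (a :: u =P mkseq (x \o succn) (size u).+1) => [e|_]; last first.
  by rewrite !andbF if_same addr0.
rewrite !andbT e (Lx (size u).+1).
by case: (x 0%N); rewrite ?addr0 ?add0r.
Qed.

(* As there is a single exceptional word y, the errors of the two summands of
   [tree_shift] never add up. *)
Definition agree (W : set (seq bool)) (d : R) c c' : Prop :=
  exists y, forall u, W u ->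
    (u <> y -> c u = c' u) /\ `|c u - c' u| <= d.

Lemma agree_shift (W W' : set (seq bool)) d c c' : 0 <= d ->
  (forall u, W' u -> W (true :: u)) ->
  (forall u, W' u -> L u -> W (false :: u)) ->
  agree W d c c' -> agree W' d (tree_shift c) (tree_shift c').
Proof.
move=> d0 Wt Wf [y yP]; exists (behead y) => -[|a u].
  by rewrite !coord_nil subrr normr0.
move=> Wu; rewrite !tree_shiftE; have [ht nt] := yP _ (Wt _ Wu).
case: ifP => Lu; last first.
  rewrite !addr0; split=> // uy; apply: ht => e; apply: uy; by rewrite -e.
have [hf nf] := yP _ (Wf _ Wu Lu); split.
  by move=> uy; rewrite ht ?hf// => e; apply: uy; rewrite -e.
have [e|ne] := eqVneq y (true :: a :: u).
  by rewrite hf ?e// opprD addrACA subrr addr0.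
rewrite ht; last by apply/eqP; rewrite eq_sym.
by rewrite opprD addrACA subrr add0r.
Qed.

(* The first n iterates of a point have, on words of length at most m, coordinates
   that depend only on the coordinates of the point on these words. *)
Definition test_words (n m : nat) : set (seq bool) :=
  [set u | (size u <= n + m)%N /\
    ((exists i v, [/\ (i <= n)%N, (size v <= m)%N & u = nseq i true ++ v]) \/
     (exists i v, [/\ (i <= n)%N, L v & u = nseq i true ++ false :: v]))].

(** One step reads the coordinate on [u] from [true :: u] and, for [u] in [L], from [false :: u].
    Both are test words if [u] is a test word for one iterate fewer. *)
Lemma agree_iter n m d c c' i : 0 <= d -> (i <= n)%N ->
  agree (test_words n m) d c c' ->
  agree (test_words (n - i) m) d (iter i tree_shift c) (iter i tree_shift c').
Proof.
move=> d0; elim: i => [|i IH] ltin; first by rewrite subn0.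
move=> /(IH (ltnW ltin)) /=; apply: agree_shift => // u [su uP].
  split; first by rewrite /=; lia.
  case: uP => -[j [v [jn vP ->]]]; [left|right].
    by exists j.+1, v; split=> //; lia.
  by exists j.+1, v; split=> //; lia.
move=> Lu; split; first by rewrite /=; lia.
by right; exists 0%N, u.
Qed.

Lemma agree_bowen n m (e : R) c c' : (2 ^+ m)^-1 <= e ->
  agree (test_words n m) e c c' -> bowen_dist tree_shift n c c' <= e.
Proof.
move=> me ag; have e0 : 0 <= e by rewrite (le_trans _ me)// invr_ge0 exprn_ge0.
apply/bowen_distP => // i lin.
have [y yP] := agree_iter e0 (ltnW lin) ag.
apply: mdist_tree_le me _ => u um; apply: (yP u _).2.
split; first lia.
by left; exists 0%N, u.
Qed.

Lemma longest_word (s : seq (seq bool)) c : [::] \in s ->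
  exists y, [/\ y \in s, 0 < c y & forall u, u \in s -> 0 < c u -> (size u <= size y)%N].
Proof.
move=> s0; pose P k := has (fun u => (0 < c u) && (size u == k)) s.
have ex : exists k, P k.
  by exists 0%N; apply/hasP; exists [::] => //; rewrite coord_nil ltr01.
have bd k : P k -> (k <= \max_(u <- s) size u)%N.
  by move=> /hasP[u us /andP[_ /eqP<-]]; exact: leq_bigmax_seq.
case: (ex_maxnP ex bd) => k /hasP[y ys /andP[cy /eqP yk]] kmax.
exists y; split=> // u us cu; rewrite yk; apply: kmax; apply/hasP.
by exists u => //; rewrite cu eqxx.
Qed.

(** Such a [u] is a proper prefix of [y], and both points reach the edge of [y]. *)
Lemma same_longest (s : seq (seq bool)) c c' y u : u \in s ->
  0 < c y -> 0 < c' y -> (forall u, u \in s -> 0 < c u -> (size u <= size y)%N) ->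
  u <> y -> 0 < c u -> c u = 1 /\ c' u = 1.
Proof.
move=> us cy c'y hy uy cu; have le := hy u us cu.
have e := coord_comparable cu cy le.
have lt : (size u < size y)%N.
  rewrite ltn_neqAle le andbT; apply/eqP => e'; apply: uy.
  by rewrite e e' take_size.
by rewrite {1}e {2}e !coord_take.
Qed.

(* The code of c is the longest word y of s with c y > 0, with c y rounded. *)
Lemma agree_code (s : seq (seq bool)) (W : set (seq bool)) (K : nat) :
  [::] \in s -> (forall u, W u -> u \in s) -> (0 < K)%N ->
  exists code : tree R -> 'I_(size s) * 'I_K.+1,
    forall c c', code c = code c' -> agree W K%:R^-1 c c'.
Proof.
move=> s0 Ws K0.
have /choice[code codeP] : forall c, exists k : 'I_(size s) * 'I_K.+1,
    let y := nth [::] s k.1 in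
    [/\ 0 < c y, forall u, u \in s -> 0 < c u -> (size u <= size y)%N &
        k.2%:R <= K%:R * c y < k.2.+1%:R].
  move=> c; have [y [ys cy ymax]] := longest_word c s0.
  have iy : (index y s < size s)%N by rewrite index_mem.
  have ge0 : 0 <= K%:R * c y by rewrite mulr_ge0 ?ler0n ?coord_ge0.
  have kK : (Num.truncn (K%:R * c y) < K.+1)%N.
    rewrite ltnS -(ler_nat R) (@le_trans _ _ (K%:R * c y)) ?truncn_le//.
    by rewrite ler_piMr ?ler0n ?coord_le1.
  by exists (Ordinal iy, Ordinal kK); rewrite /= nth_index//; split=> //; exact: truncn_itv.
exists code => c c' cc'; move: (codeP c) (codeP c'); rewrite -cc' /=.
set y := nth _ _ _ => -[cy ymax kc] [c'y ymax' kc'].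
have K0' : 0 < K%:R :> R by rewrite ltr0n.
exists y => u /Ws us; have neq : u <> y -> c u = c' u.
  move=> uy; have [cu|cu] := ltP 0 (c u).
    by have [-> ->] := same_longest us cy c'y ymax uy cu.
  have [c'u|c'u] := ltP 0 (c' u).
    by have [-> ->] := same_longest us c'y cy ymax' uy c'u.
  by apply/eqP; rewrite eq_le (le_trans cu) ?coord_ge0// (le_trans c'u) ?coord_ge0.
split=> //; have [->|/eqP/neq->] := eqVneq u y; last first.
  by rewrite subrr normr0 invr_ge0 ler0n.
rewrite -div1r ler_pdivlMr// mulrC -{1}(gtr0_norm K0') -normrM mulrBr ler_norml.
move: kc kc'; rewrite -natr1; move: (_%:R) => k /andP[? ?] /andP[? ?].
by apply/andP; split; lra.
Qed.

(** There are [n.+1] possible runs of [true], each followed by a short word or by [false] and a word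
    of [L], whose length is at most [n + m]. *)
Lemma test_words_list n m (S : nat -> seq (seq bool)) :
  (forall k u, L u -> size u = k -> u \in S k) ->
  exists s : seq (seq bool), [/\ [::] \in s, forall u, test_words n m u -> u \in s &
    (size s <= n.+1 * (size (short_words m) + \sum_(k < (n + m).+1) size (S k)))%N].
Proof.
move=> SP.
pose tails := short_words m ++
  map (cons false) (flatten [seq S k | k <- iota 0 (n + m).+1]).
exists [seq nseq i true ++ v | i <- iota 0 n.+1, v <- tails]; split.
- apply/allpairsP; exists (0%N, [::]) => /=; split=> //.
  by rewrite mem_cat mem_short_words.
- move=> u [su []] [i [v [ilen vP e]]]; apply/allpairsP.
    by exists (i, v); rewrite mem_iota/= mem_cat mem_short_words vP; split.
  exists (i, false :: v); rewrite mem_iota/=; split=> //.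
  rewrite mem_cat; apply/orP; right; apply/mapP; exists v => //.
  apply/flatten_mapP; exists (size v); last exact: SP.
  by rewrite mem_iota /=; move: su; rewrite e size_cat /=; lia.
- rewrite size_allpairs size_iota size_cat size_map size_flatten /shape -map_comp.
  by rewrite sumnE big_map -(big_mkord xpredT (fun k => size (S k))) /index_iota subn0.
Qed.

Lemma tree_shift_entropy0 :
  (forall e : R, 0 < e -> exists2 C : R, 0 <= C & forall k,
    exists s : seq (seq bool), (size s)%:R <= C * expR (e * k%:R) /\
      forall u, L u -> size u = k -> u \in s) ->
  topological_entropy tree_shift = 0%E.
Proof.
move=> growth; apply: (topological_entropy_eq0 (branch (fun=> true) 0)) => e e0.
apply: entropy_at_le0 => d d0.
have [m /ltW me] := exists_expn_lt e0.
pose K := (Num.truncn e^-1).+1.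
have Ke : K%:R^-1 <= e.
  by rewrite -[leRHS]invrK lef_pV2 ?posrE ?invr_gt0 ?ltr0n// ltW ?truncnS_gt.
(* Three factors grow with [n]: the number of runs of [true], the number of lengths of words of [L],
   and the number of words of each length. Each is allowed the rate [d / 3]. *)
pose a := d / 3; have a0 : 0 < a by rewrite divr_gt0.
have [C C0 hC] := growth a a0.
have [S SP] := choice hC.
pose M := m.+1%:R : R.
exists ((a^-1 * expR a * ((size (short_words m))%:R + a^-1 * expR (a * M) * (C * expR (a * M)))) * K.+1%:R) => n.
have [s [s0 sW sz]] := @test_words_list n m S (fun k => (SP k).2).
have [code codeP] := @agree_code s (test_words n m) K s0 sW isT.
have := @separation_number_le R _ tree_shift _ code n e.
move=> /(_ _)/le_trans -> //.
  move=> c c' /codeP[y yP]; apply: agree_bowen me _; exists y => u /yP[? h].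
  by split=> //; exact: le_trans Ke.
rewrite card_prod !card_ord lee_fin natrM mulrAC ler_wpM2r ?ler0n//.
rewrite (@le_trans _ _ ((n.+1 * (size (short_words m) + \sum_(k < (n + m).+1) size (S k)))%:R))//.
  by rewrite ler_nat.
have lin (k : nat) : k%:R <= a^-1 * expR (a * k%:R).
  by rewrite ler_pdivlMl// (le_trans _ (expR_ge1Dx _))// lerDr.
have e3 : d = a + (a + a) by rewrite /a; field.
have -> : expR (d * n%:R) = expR (a * n%:R) * (expR (a * n%:R) * expR (a * n%:R)).
  by rewrite -!expRD e3 !mulrDl.
have E1 : 1 <= expR (a * n%:R) by rewrite -expR0 ler_expR mulr_ge0 ?ler0n// ltW.
have EM : expR (a * (n + m).+1%:R) = expR (a * M) * expR (a * n%:R).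
  by rewrite -expRD -mulrDr -natrD; congr (expR (_ * _%:R)); rewrite /= addnC; lia.
rewrite natrM natrD natr_sum.
have hn : n.+1%:R <= a^-1 * expR a * expR (a * n%:R).
  by rewrite (le_trans (lin _))// -mulrA -expRD -natr1 mulrDr mulr1 addrC.
have hs : \sum_(k < (n + m).+1) (size (S k))%:R <=
    a^-1 * expR (a * M) * (C * expR (a * M)) * (expR (a * n%:R) * expR (a * n%:R)).
  rewrite (@le_trans _ _ (\sum_(k < (n + m).+1) C * expR (a * (n + m).+1%:R)))//.
    apply: ler_sum => k _; rewrite (le_trans (SP k).1)// ler_wpM2l// ler_expR ler_pM2l//.
    by rewrite ler_nat ltnW.
  rewrite sumr_const card_ord EM -[leLHS]mulr_natl.
  rewrite (_ : _ * _ * (C * _) * _ = (a^-1 * (expR (a * M) * expR (a * n%:R))) *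
    (C * (expR (a * M) * expR (a * n%:R)))); last by ring.
  rewrite ler_wpM2r ?mulr_ge0 ?expR_ge0// -EM; exact: lin.
rewrite [leRHS](_ : _ = (a^-1 * expR a * expR (a * n%:R)) *
  (((size (short_words m))%:R + a^-1 * expR (a * M) * (C * expR (a * M))) *
   (expR (a * n%:R) * expR (a * n%:R)))); last by ring.
rewrite ler_pM ?ler0n ?addr_ge0 ?sumr_ge0// mulrDl lerD//.
by rewrite ler_peMr ?ler0n// mulr_ege1.
Qed.

End tree_shift.

(** * Moebius averages *)

Section averages.
Context {R : realType}.

Definition mobius_average (a : nat -> R[i]^o) (N : nat) : R[i]^o :=
  N%:R^-1 * \sum_(1 <= n < N.+1) (mobius n)%:~R * a n.

Lemma norm_mobius_le1 n : `|(mobius n)%:~R : R[i]| <= 1.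
Proof.
rewrite /mobius; case: ifP => _; last by rewrite mulr0z normr0 ler01.
by rewrite rmorphXn rmorphN1 normrX normrN1 expr1n.
Qed.

Lemma norm_mobius_average_le (a : nat -> R[i]^o) (e : R[i]) N : 0 <= e ->
  (forall n, `|a n| <= e) -> `|mobius_average a N| <= e.
Proof.
move=> e0 ae; rewrite /mobius_average.
case: N => [|N]; first by rewrite invr0 mul0r normr0.
rewrite normrM normfV normr_nat mulrC ler_pdivrMr ?ltr0n//.
rewrite (le_trans (ler_norm_sum _ _ _))//.
rewrite (@le_trans _ _ (\sum_(1 <= n < N.+2) e))//.
  apply: ler_sum => n _; rewrite normrM -[leRHS]mul1r.
  by rewrite ler_pM// norm_mobius_le1.
by rewrite sumr_const_nat subSS subn0 mulr_natr.
Qed.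

Lemma mobius_averageD (a b : nat -> R[i]^o) N :
  mobius_average (fun n => a n + b n) N = mobius_average a N + mobius_average b N.
Proof.
rewrite /mobius_average -mulrDr -big_split; congr (_ * _).
by apply: eq_bigr => n _; rewrite mulrDr.
Qed.

Lemma mobius_average_sum (I : Type) (s : seq I) (k : I -> R[i])
    (a : I -> nat -> R[i]^o) N :
  mobius_average (fun n => \sum_(i <- s) k i * a i n) N =
  \sum_(i <- s) k i * mobius_average (a i) N.
Proof.
rewrite /mobius_average.
under eq_bigr do rewrite mulr_sumr.
rewrite exchange_big mulr_sumr; apply: eq_bigr => i _.
rewrite mulrCA; congr (_ * _); rewrite mulr_sumr.
by apply: eq_bigr => n _; rewrite mulrCA.
Qed.

Lemma norm_real_complex (x : R) : `|real_complex R x| = real_complex R `|x|.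
Proof. by rewrite normc_def /= expr0n addr0 sqrtr_sqr. Qed.

Lemma real_complex_continuous : continuous (real_complex R : R -> R[i]^o).
Proof.
move=> x; apply/cvgrPdist_lt => e; rewrite ltcE => /andP[/eqP im0 re0].
have : \forall y \near x, `|x - y| < complex.Re e.
  by have /cvgrPdist_lt := @cvg_id _ (nbhs x); exact.
apply: filterS => y xy; rewrite -rmorphB norm_real_complex.
by rewrite ltcE /= im0 eqxx.
Qed.

Lemma compact_uniform_continuity (X : metricType R) (phi : X -> R[i]^o) (e : R[i]) :
  compact [set: X] -> continuous phi -> 0 < e ->
  exists2 d : R, 0 < d & forall y z, mdist y z <= d -> `|phi y - phi z| <= e.
Proof.
move=> /compact_near_coveringP cX cphi e0.
have e20 : 0 < e / 2 by rewrite divr_gt0.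
have : \forall d \near (0 : R)^'+, [set: X] `<=`
    (fun y => forall z, mdist y z <= d -> `|phi y - phi z| <= e).
  apply: cX => x _.
  have FF : Filter (nbhs x) by exact: nbhs_filter.
  have /cvgrPdist_lt/(_ _ e20) := cphi x.
  rewrite -filter_from_ballE => -[r /= r0 hr].
  have r20 : 0 < r / 2 by rewrite divr_gt0.
  exists (ball x (r / 2), [set d | d < r / 2]) => /=.
    by split; [exact: nbhsx_ballx|exact: nbhs_right_lt].
  move=> [y d] /= [xy dr] z yz.
  rewrite ballEmdist/= in xy.
  have hy : ball x r y by rewrite ballEmdist/=; lra.
  have hz : ball x r z.
    by rewrite ballEmdist/= (le_lt_trans (metric_triangle x y z))//; lra.
  have -> : phi y - phi z = (phi x - phi z) - (phi x - phi y) by ring.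
  rewrite (le_trans (ler_normB _ _))// [leRHS]splitr lerD ?ltW//; exact: hr.
move=> [r /= r0 hr]; exists (r / 2); first by rewrite divr_gt0.
move=> y z; apply: (hr (r / 2)) => //=; last by rewrite divr_gt0.
by rewrite sub0r normrN gtr0_norm ?divr_gt0//; lra.
Qed.

End averages.

(** * From binary sequences to arbitrary systems of zero entropy *)

Section reduction.
Context {R : realType}.

(** With [L] the set of factors of [z], the end [z] moves under [tree_shift] as under the shift, and
    the coordinate at [[:: true]] is a continuous function that reads the first letter of an end. *)
Lemma low_complexity_mobius (z : nat -> bool) :
  (forall (D : metricType R) (f : D -> D),
     gehman_dendrite D -> dynamical_system f -> range f = [set: D] ->
     topological_entropy f = 0%E -> mobius_disjoint f) ->
  low_complexity R z ->
  mobius_average (fun n => (z n)%:R : R[i]^o) @ \oo --> (0 : R[i]^o).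
Proof.
move=> gehman_disjoint lz.
pose L (u : seq bool) := `[< exists s, u = factor z s (size u) >].
have Lr u b : L (rcons u b) -> L u.
  move=> /asboolP[s]; rewrite size_rcons /factor mkseqS => /rcons_inj[e _].
  by apply/asboolP; exists s.
have LF s k : L (factor z s k).
  by apply/asboolP; exists s; rewrite size_mkseq.
pose f := @tree_shift R L Lr.
pose phi (c : tree R) : R[i]^o := real_complex R (c [:: true]).
have cphi : continuous phi.
  move=> c; apply: (continuous_comp (@tree_coord_continuous R [:: true] c)).
  exact: real_complex_continuous.
have ent : topological_entropy f = 0%E.
  apply: tree_shift_entropy0 => e e0.
  have [C C0 hC] := low_complexity_factors lz e0.
  exists C => // k; have [S [sS SP]] := hC k; exists S; split=> // u /asboolP[s es] uk.
  by rewrite es uk.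
have := gehman_disjoint (tree R) f tree_gehman
  (conj tree_compact (@tree_shift_continuous _ _ Lr)) (@tree_shift_surj _ _ Lr) ent
  (branch z 1) phi cphi.
have orbit n : iter n f (branch z 1) = branch (fun i => z (n + i)%N) 1.
  elim: n => [|n IH]; first by [].
  have e : (fun i => z (n.+1 + i)%N) = (fun i => z (n + i)%N) \o succn.
    by apply/funext => i /=; rewrite addSnnS.
  rewrite iterS IH e; apply: tree_shift_branch => k.
  by rewrite -e; exact: LF.
suff -> : (fun n => (z n)%:R : R[i]^o) = (fun n => phi (iter n f (branch z 1))).
  by [].
apply/funext => n; rewrite orbit /phi branchE edge_ratio1 /mkseq /= addn0.
by rewrite eqseq_cons andbT; case: (z n).
Qed.

(** Along the shadow, [phi] is a finite linear combination of indicators of the values, each a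
    binary sequence of low complexity. Replacing the orbit by the shadow changes every term, hence
    every average, by at most [e / 3]. *)
Lemma gehman_mobius_disjoint (X : metricType R) (T : X -> X) :
  (forall (D : metricType R) (f : D -> D),
     gehman_dendrite D -> dynamical_system f -> range f = [set: D] ->
     topological_entropy f = 0%E -> mobius_disjoint f) ->
  dynamical_system T -> topological_entropy T = 0%E -> mobius_disjoint T.
Proof.
move=> gehman_disjoint [cX _] ent0 x phi cphi.
rewrite -[X in X @ _]/(mobius_average (fun n => phi (iter n T x))).
apply/cvgrPdist_lt => e e0; have e30 : 0 < e / 3 by rewrite divr_gt0// ltr0n.
have [d d0 dphi] := compact_uniform_continuity cX cphi e30.
have [z lz [E zE xz]] := exists_shadow ent0 d0 x.
pose a y n : R[i]^o := (z n == y)%:R.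
have za n : phi (z n) = \sum_(y <- undup E) phi y * a y n.
  rewrite (bigD1_seq (z n)) ?mem_undup ?undup_uniq//= /a eqxx mulr1 big1 ?addr0// => y.
  by rewrite eq_sym => /negPf->; rewrite mulr0.
have cz : mobius_average (fun n => phi (z n)) @ \oo --> (0 : R[i]^o).
  have -> : mobius_average (fun n => phi (z n)) =
      fun N => \sum_(y <- undup E) phi y * mobius_average (a y) N.
    apply/funext => N; rewrite -mobius_average_sum; congr (mobius_average _ N).
    exact/funext.
  rewrite [X in _ --> X](_ : _ = \sum_(y <- undup E) phi y * 0); last first.
    by rewrite big1// => y _; rewrite mulr0.
  apply: cvg_big => [|y _]; first exact: add_continuous.
  apply: (@cvgM R[i]); first exact: cvg_cst.
  apply: (@low_complexity_mobius (fun n => z n == y)) => //.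
  exact: (low_complexity_comp (fun w => w == y) lz).
have split_avg N : mobius_average (fun n => phi (iter n T x)) N =
    mobius_average (fun n => phi (z n)) N +
    mobius_average (fun n => phi (iter n T x) - phi (z n)) N.
  rewrite -mobius_averageD; congr (mobius_average _ N).
  by apply/funext => n; rewrite subrKC.
have /cvgrPdist_lt/(_ _ e30) := cz; apply: filterS => N; rewrite !sub0r !normrN => hN.
rewrite split_avg (le_lt_trans (ler_normD _ _))//.
have -> : e = e / 3 + (e / 3 + e / 3) by field.
rewrite ltr_leD// (@le_trans _ _ (e / 3))//; last by rewrite lerDl ltW.
by apply: norm_mobius_average_le => [|n]; [exact: ltW|exact: dphi].
Qed.

End reduction.

Theorem corollary1p6 (R : realType) :
  (forall (X : metricType R) (T : X -> X),
     dynamical_system T -> topological_entropy T = 0%E -> mobius_disjoint T)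
  <->
  (forall (D : metricType R) (f : D -> D),
     gehman_dendrite D -> dynamical_system f -> range f = [set: D] ->
     topological_entropy f = 0%E -> mobius_disjoint f).
Proof.
split=> [disjoint D f _ sysf _|disjoint X T]; first exact: disjoint.
exact: gehman_mobius_disjoint.
Qed.
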